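(* Unweighted no-self-APSD enumeration can be solved (without preprocessing) with delay in $O(\overline{\Delta})$ and with space complexity in $\Theta(n)$.
   Context: Input: a directed or undirected unweighted graph $G=(V,E)$, $V=\{1,\dots,n\}$. $\overline{\Delta}$ is the average (out-)degree. $d(u,v)$ is the hop distance, $\infty$ if unreachable. No-self-APSD enumeration: output, for each ordered pair $u\neq v$ of vertices, the triple $(u,v,d(u,v))$ exactly once (the triples $(u,u,0)$ are not output). Delay in $O(f)$: time to first output, between consecutive outputs, and to signal termination are each $O(f)$. Model: word RAM with word size $\Omega(\log n)$, read-only adjacency lists with constant-time access to $n$ and vertex degrees.
   Formalization: The delay is bounded by O(1 + average degree) instead of O(average degree), because the literal bound fails for graphs whose average degree is 0 or tends to 0 (e.g. the edgeless graph on two vertices), where the delay is still at least one step. *)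

(* Defs.v *)
From HB Require Import structures.
From mathcomp Require Import all_boot all_order all_algebra.
Set Implicit Arguments.
Unset Strict Implicit.
Unset Printing Implicit Defensive.
Import Order.TTheory GRing.Theory Num.Theory.

(* A graph on V = {1, .., n} is an arbitrary relation E on 'I_n, the ordinal  *)
(* i standing for the vertex i.+1.  An undirected graph is a symmetric E.     *)

Definition has_walk (T : finType) (E : rel T) (u v : T) (k : nat) : bool :=
  [exists p : k.-tuple T, path E u p && (v == last u p)].

Lemma connect_has_walk (T : finType) (E : rel T) (u v : T) :
  connect E u v -> exists k, has_walk E u v k.
Proof.
case/connectP=> p Ep vE; exists (size p).
by apply/existsP; exists (in_tuple p); rewrite Ep vE eqxx.
Qed.

(* Hop distance; None stands for infinity. *)
Definition dist (T : finType) (E : rel T) (u v : T) : option nat :=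
  if @idP (connect E u v) is ReflectT uv
  then Some (ex_minn (connect_has_walk uv)) else None.

Definition triple : Type := (nat * nat * option nat)%type.

Definition no_self_apsd n (E : rel 'I_n) : seq triple :=
  [seq (u.+1, v.+1, dist E u v)
     | u : 'I_n <- enum 'I_n, v : 'I_n <- [seq v <- enum 'I_n | v != u]].

(* Every undirected edge {u, v} with u != v is counted at u and at v, as in   *)
(* the adjacency lists.                                                       *)
Definition avg_degree n (E : rel 'I_n) : rat :=
  ((\sum_(u < n) #|E u|)%N%:R / n%:R)%R.

(* Read-only input.  [inp] is a memory of w-bit words in which address 0      *)
(* holds n, address u holds the (out-)degree of the vertex u, and address     *)
(* n + u holds a pointer to the linked adjacency list of u.  A list cell at   *)
(* address p occupies the words p (a vertex) and p.+1 (pointer to the next    *)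
(* cell); the pointer 0 is the empty list.  The order of the lists and the    *)
(* placement of the cells are arbitrary.                                      *)

Fixpoint linked_list w (inp : nat -> nat) (p : nat) (s : seq nat) : Prop :=
  if s is x :: s' then
    [/\ 0 < p, p.+1 < 2 ^ w, inp p = x & linked_list w inp (inp p.+1) s']
  else p = 0.

Definition represents w n (E : rel 'I_n) (inp : nat -> nat) : Prop :=
  [/\ forall a, inp a < 2 ^ w,
      inp 0 = n
    & forall u : 'I_n, inp u.+1 = #|E u| /\
        exists s : seq 'I_n,
          [/\ uniq s, s =i E u
            & linked_list w inp (inp (n + u.+1)) [seq v.+1 | v : 'I_n <- s]]].

(* Word RAM with w-bit words.  A program names finitely many registers, so    *)
(* registers account for O(1) words; everything else lives in the working     *)
(* memory, reached through LoadMem and StoreMem only.                         *)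

Inductive binop :=
  BAdd | BSub | BMul | BDiv | BMod | BAnd | BOr | BXor | BShl | BShr.

Inductive instr :=
| Const of nat & nat             (* r := c *)
| Op of binop & nat & nat & nat  (* r := r1 op r2 *)
| LoadMem of nat & nat           (* r := mem[r1] *)
| StoreMem of nat & nat          (* mem[r] := r1 *)
| ReadInp of nat & nat           (* r := inp[r1] *)
| Jmp of nat
| Jeq of nat & nat & nat         (* if r1 = r2 goto l *)
| Jlt of nat & nat & nat         (* if r1 < r2 goto l *)
| Out of nat & nat & nat         (* output (r1, r2, r3) *)
| OutInf of nat & nat            (* output (r1, r2, infinity) *)
| Halt.

Definition program := seq instr.

Record state := State { pc : nat; reg : nat -> nat; mem : nat -> nat }.

Definition upd (f : nat -> nat) (a x : nat) : nat -> nat :=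
  fun b => if b == a then x else f b.

(* Results are reduced modulo 2 ^ w; BSub wraps around. *)
Definition binop_eval (w : nat) (o : binop) (x y : nat) : nat :=
  (match o with
   | BAdd => x + y
   | BSub => x + (2 ^ w - y)
   | BMul => x * y
   | BDiv => x %/ y
   | BMod => x %% y
   | BAnd => Nat.land x y
   | BOr => Nat.lor x y
   | BXor => Nat.lxor x y
   | BShl => x * 2 ^ y
   | BShr => x %/ 2 ^ y
   end) %% 2 ^ w.

Definition exec w (inp : nat -> nat) (i : instr) (s : state) : state :=
  let: State l r m := s in
  match i with
  | Const a c => State l.+1 (upd r a (c %% 2 ^ w)) m
  | Op o a b c => State l.+1 (upd r a (binop_eval w o (r b) (r c))) m
  | LoadMem a b => State l.+1 (upd r a (m (r b))) m
  | StoreMem a b => State l.+1 r (upd m (r a) (r b))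
  | ReadInp a b => State l.+1 (upd r a (inp (r b))) m
  | Jmp l' => State l' r m
  | Jeq a b l' => State (if r a == r b then l' else l.+1) r m
  | Jlt a b l' => State (if r a < r b then l' else l.+1) r m
  | Out _ _ _ | OutInf _ _ => State l.+1 r m
  | Halt => s
  end.

Definition emitted (i : instr) (s : state) : option triple :=
  match i with
  | Out a b c => Some (reg s a, reg s b, Some (reg s c))
  | OutInf a b => Some (reg s a, reg s b, None)
  | _ => None
  end.

Definition accessed (i : instr) (s : state) : seq nat :=
  match i with
  | LoadMem _ b => [:: reg s b]
  | StoreMem a _ => [:: reg s a]
  | _ => [::]
  end.

Definition is_halt (i : instr) : bool := if i is Halt then true else false.

(* Leaving the program text amounts to halting. *)
Definition fetch (P : program) (s : state) : instr := nth Halt P (pc s).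

Section Run.
Variables (w : nat) (P : program) (inp mem0 : nat -> nat).

(* The working memory initially has arbitrary contents [mem0]. *)
Definition run (t : nat) : state :=
  iter t (fun s => exec w inp (fetch P s) s) (State 0 (fun=> 0) mem0).

Definition instr_at (t : nat) : instr := fetch P (run t).

Definition emitted_at (t : nat) : option triple :=
  emitted (instr_at t) (run t).

Definition halts_at (T : nat) : Prop :=
  is_halt (instr_at T) /\ forall t, t < T -> ~~ is_halt (instr_at t).

Definition outputs (T : nat) : seq triple := pmap emitted_at (iota 0 T).

(* The instruction with index t completes at time t.+1; for a run halting at  *)
(* T the last event is the completion of Halt.                                *)
Definition event_times (T : nat) : seq nat :=
  rcons [seq t.+1 | t <- iota 0 T & isSome (emitted_at t)] T.+1.

(* Maximum of the time to the first event and of the gaps between consecutive *)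
(* events.                                                                    *)
Definition delay (T : nat) : nat :=
  \max_(d <- pairmap (fun t t' => t' - t) 0 (event_times T)) d.

Definition accesses (T : nat) : seq nat :=
  flatten [seq accessed (instr_at t) (run t) | t <- iota 0 T].

(* Two measures of the working space: the number of distinct words accessed,  *)
(* and the length of the shortest initial segment of the working memory that  *)
(* contains them.  The former is at most the latter.                          *)
Definition words_used (T : nat) : nat := size (undup (accesses T)).

Definition memory_extent (T : nat) : nat := \max_(a <- accesses T) a.+1.

End Run.

(* Main.v *)
Require Import Defs.
From HB Require Import structures.
From mathcomp Require Import all_boot all_order all_algebra.
From mathcomp Require Import zify.
Set Implicit Arguments.
Unset Strict Implicit.
Unset Printing Implicit Defensive.
Import Order.TTheory GRing.Theory Num.Theory.

(* Give each vertex u a partner f(u) <> u: a proper out-neighbour if u has    *)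
(* one, and otherwise any other vertex, which is then unreachable. The n      *)
(* triples of the pairs (u, f(u)) can be output at constant delay. During the *)
(* first half of these outputs the degrees are summed, which gives K =        *)
(* Theta(1 + m / n); during the second half K steps of the search from vertex *)
(* 1 are made after each output, and this completes the search. Then, for     *)
(* each source s in turn, the remaining triples of s are read off its         *)
(* finished table, one per slot of K steps of the search from s + 1, which    *)
(* fills a second table. In the n slots of s only the targets s and f(s) are  *)
(* skipped, so only boundedly many slots in a row are silent.                 *)

(** A search takes at most 2n + m constant-time steps, m being the sum of the degrees and the
    initialisation of the table being included. A source offers n output slots, so with K = Theta(1
    + m/n) steps per slot the search from the next source is complete when the table of the current
    one has been read off. Only the start is delicate, since neither K nor a table is available
    then. The partner pairs bridge it: their distance is 1 or infinity and needs no search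
    ([dist_first]), and since f(u) differs from u ([first_neq]) omitting them later leaves every
    pair output once ([perm_source_outs]).

    K is calibrated from both sides: [budget_work] says that the slots left after the degree count
    cover a whole search, [budget_leq] that n K = O(m + n), which is the delay bound. A search can
    be suspended anywhere because the potential [bfs_weight] drops at each step until the search is
    over ([bfs_step_spec]); that the finished table holds distances follows from the queue invariant
    [bfs_inv] ([bfs_inv_dist]). The two tables alternate, so a search never writes where outputs are
    read; with the shared queue this is 3n words, and reading one table already touches n.

    The program is written in a goto-free language whose runs produce traces. [follows_compile]
    carries such a run over to the RAM, [exw] serves as a Hoare logic, and [paced] makes the delay
    compositional: idle time before and after a piece of trace. *)

(** * A structured language over the word RAM *)

(* One entry per executed instruction: its output and the working-memory words it touches. *)
Definition trace := seq (option triple * seq nat).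
Definition mapping := nat -> nat.

Inductive cmd :=
| Ins of instr
| Skip
| Seq of cmd & cmd
| IfEq of nat & nat & cmd & cmd
| While of nat & nat & cmd.  (* while r1 <> r2 *)

Fixpoint csize (c : cmd) : nat :=
  match c with
  | Ins _ => 1
  | Skip => 0
  | Seq c1 c2 => csize c1 + csize c2
  | IfEq _ _ c1 c2 => (csize c2 + csize c1).+2
  | While _ _ c => (csize c).+2
  end.

(* The code of [c] is position dependent: it is meant to be loaded at [l]. *)
Fixpoint compile (l : nat) (c : cmd) : program :=
  match c with
  | Ins i => [:: i]
  | Skip => [::]
  | Seq c1 c2 => compile l c1 ++ compile (l + csize c1) c2
  | IfEq a b c1 c2 =>
      Jeq a b (l + (csize c2).+2)
        :: compile l.+1 c2
        ++ Jmp (l + (csize c2 + csize c1).+2)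
        :: compile (l + (csize c2).+2) c1
  | While a b c =>
      Jeq a b (l + (csize c).+2) :: compile l.+1 c ++ [:: Jmp l]
  end.

Lemma size_compile l c : size (compile l c) = csize c.
Proof.
elim: c l => //= [c1 IH1 c2 IH2|a b c1 IH1 c2 IH2|a b c IH] l.
- by rewrite size_cat IH1 IH2.
- by rewrite size_cat /= IH1 IH2 addnS.
- by rewrite size_cat /= IH addn1.
Qed.

Definition straight (i : instr) : bool :=
  match i with Jmp _ | Jeq _ _ _ | Jlt _ _ _ | Halt => false | _ => true end.

Definition written (i : instr) : seq nat :=
  match i with
  | Const a _ | Op _ a _ _ | LoadMem a _ | ReadInp a _ => [:: a]
  | _ => [::]
  end.

Fixpoint writes (c : cmd) : seq nat :=
  match c with
  | Ins i => written i
  | Skip => [::]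
  | Seq c1 c2 | IfEq _ _ c1 c2 => writes c1 ++ writes c2
  | While _ _ c => writes c
  end.

Definition nop : option triple * seq nat := (None, [::]).
Definition outs (tr : trace) : seq triple := pmap fst tr.
Definition accs (tr : trace) : seq nat := flatten (map snd tr).

Lemma outs_cat t1 t2 : outs (t1 ++ t2) = outs t1 ++ outs t2.
Proof. exact: pmap_cat. Qed.
Lemma accs_cat t1 t2 : accs (t1 ++ t2) = accs t1 ++ accs t2.
Proof. by rewrite /accs map_cat flatten_cat. Qed.

Lemma outs_nop t : outs (nop :: t) = outs t.
Proof. by []. Qed.
Lemma accs_nop t : accs (nop :: t) = accs t.
Proof. by []. Qed.
Lemma outs_rcons_nop t : outs (rcons t nop) = outs t.
Proof. by rewrite -cats1 outs_cat cats0. Qed.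
Lemma accs_rcons_nop t : accs (rcons t nop) = accs t.
Proof. by rewrite -cats1 accs_cat cats0. Qed.

Definition outsE := (outs_nop, outs_rcons_nop, outs_cat).
Definition accsE := (accs_nop, accs_rcons_nop, accs_cat).

Section Semantics.
Variables (w : nat) (inp : nat -> nat).

(** The [nop] entries account for the tests and jumps of the compiled code: an else-branch is placed
    first and pays one more jump over the then-branch, and each round of a loop pays its test and
    the jump back. *)
Inductive bs : cmd -> mapping -> mapping -> trace -> mapping -> mapping -> Prop :=
| BsIns i r m : straight i ->
    bs (Ins i) r m
       [:: (emitted i (State 0 r m), accessed i (State 0 r m))]
       (reg (exec w inp i (State 0 r m))) (Defs.mem (exec w inp i (State 0 r m)))
| BsSkip r m : bs Skip r m [::] r m
| BsSeq c1 c2 r m t1 r1 m1 t2 r2 m2 :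
    bs c1 r m t1 r1 m1 -> bs c2 r1 m1 t2 r2 m2 ->
    bs (Seq c1 c2) r m (t1 ++ t2) r2 m2
| BsThen a b c1 c2 r m t r1 m1 : r a = r b ->
    bs c1 r m t r1 m1 -> bs (IfEq a b c1 c2) r m (nop :: t) r1 m1
| BsElse a b c1 c2 r m t r1 m1 : r a <> r b ->
    bs c2 r m t r1 m1 -> bs (IfEq a b c1 c2) r m (nop :: rcons t nop) r1 m1
| BsStop a b c r m : r a = r b -> bs (While a b c) r m [:: nop] r m
| BsLoop a b c r m t1 r1 m1 t2 r2 m2 : r a <> r b ->
    bs c r m t1 r1 m1 -> bs (While a b c) r1 m1 t2 r2 m2 ->
    bs (While a b c) r m (nop :: rcons t1 nop ++ t2) r2 m2.

Fixpoint follows (P : program) (s : state) (tr : trace) (s' : state) : Prop :=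
  if tr is e :: tr' then
    [/\ ~~ is_halt (fetch P s), e = (emitted (fetch P s) s, accessed (fetch P s) s)
      & follows P (exec w inp (fetch P s) s) tr' s']
  else s = s'.

Lemma follows_cat P s t1 s1 t2 s2 :
  follows P s t1 s1 -> follows P s1 t2 s2 -> follows P s (t1 ++ t2) s2.
Proof.
elim: t1 s => [|e t1 IH] s /= => [-> //|[h1 h2 h3] h4]; split=> //.
exact: IH.
Qed.

Lemma fetch_cat (A B : program) i r m : fetch (A ++ i :: B) (State (size A) r m) = i.
Proof. by rewrite /fetch /= nth_cat ltnn subnn. Qed.

(** Jump targets are absolute, so the induction needs arbitrary code [A] before and [B] after the
    command, with the load address equal to the size of [A]. *)
Lemma follows_compile c r m tr r' m' :
  bs c r m tr r' m' -> forall A B,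
  follows (A ++ compile (size A) c ++ B) (State (size A) r m) tr
          (State (size A + csize c) r' m').
Proof.
elim=> {c r m tr r' m'}
  [i r m Hi|r m|c1 c2 r m t1 r1 m1 t2 r2 m2 _ IH1 _ IH2
  |a b c1 c2 r m t r1 m1 e _ IH|a b c1 c2 r m t r1 m1 e _ IH
  |a b c r m e|a b c r m t1 r1 m1 t2 r2 m2 e _ IH1 _ IH2] A B.
- rewrite /= fetch_cat; rewrite addn1; split=> //; by case: i Hi.
- by rewrite /= addn0.
- have := IH2 (A ++ compile (size A) c1) B; rewrite size_cat size_compile /= => H2.
  rewrite addnA; apply: follows_cat; last by rewrite -!catA in H2 *; exact: H2.
  by rewrite -catA; exact: IH1.
- rewrite /= fetch_cat /=; split=> //; rewrite e eqxx.
  have := IH (A ++ Jeq a b (size A + (csize c2).+2) :: compile (size A).+1 c2 ++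
              [:: Jmp (size A + (csize c2 + csize c1).+2)]) B.
  rewrite /= !size_cat /= size_cat size_compile /= addn1.
  rewrite -!catA /= -!catA /= -addnA; congr follows; congr State; lia.
- rewrite /= fetch_cat /=; split=> //; move/eqP/negbTE: (e) => ->.
  rewrite -cats1; apply: (@follows_cat _ _ _ (State ((size A).+1 + csize c2) r1 m1)).
    have := IH (rcons A (Jeq a b (size A + (csize c2).+2)))
      (Jmp (size A + (csize c2 + csize c1).+2) ::
       compile (size A + (csize c2).+2) c1 ++ B).
    by rewrite size_rcons cat_rcons -!catA /=.
  have -> : (A ++ Jeq a b (size A + (csize c2).+2) :: (compile (size A).+1 c2 ++
              Jmp (size A + (csize c2 + csize c1).+2) ::
              compile (size A + (csize c2).+2) c1) ++ B)
    = (A ++ Jeq a b (size A + (csize c2).+2) :: compile (size A).+1 c2) ++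
              Jmp (size A + (csize c2 + csize c1).+2) ::
              compile (size A + (csize c2).+2) c1 ++ B.
    by rewrite -!catA /= -?catA.
  have -> : (size A).+1 + csize c2 =
    size (A ++ Jeq a b (size A + (csize c2).+2) :: compile (size A).+1 c2).
    by rewrite size_cat /= size_compile; lia.
  by rewrite /= fetch_cat.
- by rewrite /= fetch_cat /=; split=> //; rewrite e eqxx.
- rewrite /= fetch_cat /=; split=> //; move/eqP/negbTE: (e) => ->.
  have := IH2 A B; rewrite /=.
  apply: follows_cat; rewrite -cats1.
  apply: (@follows_cat _ _ _ (State ((size A).+1 + csize c) r1 m1)).
    have := IH1 (rcons A (Jeq a b (size A + (csize c).+2)))
      (Jmp (size A) :: B).
    by rewrite size_rcons cat_rcons -!catA /=.
  have -> : (A ++ Jeq a b (size A + (csize c).+2) :: (compile (size A).+1 c ++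
              [:: Jmp (size A)]) ++ B)
    = (A ++ Jeq a b (size A + (csize c).+2) :: compile (size A).+1 c) ++
              Jmp (size A) :: B.
    by rewrite -!catA /= -?catA.
  have -> : (size A).+1 + csize c =
    size (A ++ Jeq a b (size A + (csize c).+2) :: compile (size A).+1 c).
    by rewrite size_cat /= size_compile; lia.
  by rewrite /= fetch_cat.
Qed.

Lemma bs_reg c r m tr r' m' : bs c r m tr r' m' ->
  forall a, a \notin writes c -> r' a = r a.
Proof.
elim=> {c r m tr r' m'} /=
  [i r m Hi|//|c1 c2 r m t1 r1 m1 t2 r2 m2 _ IH1 _ IH2
  |a b c1 c2 r m t r1 m1 e _ IH|a b c1 c2 r m t r1 m1 e _ IH
  |//|a b c r m t1 r1 m1 t2 r2 m2 e _ IH1 _ IH2] x.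
- by case: i Hi => //= > _; rewrite ?inE => H; rewrite /upd; rewrite (negbTE H).
- by rewrite mem_cat negb_or => /andP[h1 h2]; rewrite IH2 ?IH1.
- by rewrite mem_cat negb_or => /andP[h1 h2]; rewrite IH.
- by rewrite mem_cat negb_or => /andP[h1 h2]; rewrite IH.
- by move=> h; rewrite IH2 ?IH1.
Qed.

Lemma bs_mem c r m tr r' m' : bs c r m tr r' m' ->
  forall a, a \notin accs tr -> m' a = m a.
Proof.
elim=> {c r m tr r' m'} /=
  [i r m Hi|//|c1 c2 r m t1 r1 m1 t2 r2 m2 _ IH1 _ IH2
  |a b c1 c2 r m t r1 m1 e _ IH|a b c1 c2 r m t r1 m1 e _ IH
  |//|a b c r m t1 r1 m1 t2 r2 m2 e _ IH1 _ IH2] x; rewrite ?accs_cat.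
- by case: i Hi => //= > _; rewrite ?inE => H; rewrite /upd; rewrite (negbTE H).
- by rewrite mem_cat negb_or => /andP[h1 h2]; rewrite IH2 ?IH1.
- by rewrite -[nop :: _]cat1s accs_cat; apply: IH.
- rewrite -[nop :: _]cat1s -cats1 !accs_cat /= cats0; exact: IH.
- rewrite -[nop :: _]cat1s -cats1 !accs_cat /= cats0 mem_cat negb_or.
  by move=> /andP[h1 h2]; rewrite IH2 ?IH1.
Qed.

(** * Total-correctness rules for commands *)

Definition exw (c : cmd) (r m : mapping) (Q : trace -> mapping -> mapping -> Prop) :=
  exists tr r' m', bs c r m tr r' m' /\ Q tr r' m'.

(** Frame rule: specifications can stay silent about registers that are not written syntactically
    and about memory words absent from the trace. *)
Lemma exw_frame c r m Q : exw c r m Q ->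
  exw c r m (fun t r' m' => [/\ Q t r' m', forall a, a \notin writes c -> r' a = r a
    & forall a, a \notin accs t -> m' a = m a]).
Proof.
case=> t [r' [m' [h1 h2]]]; exists t, r', m'; split=> //; split=> //.
- exact: bs_reg h1.
- exact: bs_mem h1.
Qed.

Lemma exw_conseq c r m (Q Q' : trace -> mapping -> mapping -> Prop) :
  exw c r m Q -> (forall t r' m', Q t r' m' -> Q' t r' m') -> exw c r m Q'.
Proof. by case=> t [r' [m' [h1 h2]]] h; exists t, r', m'; split=> //; apply: h. Qed.

Lemma exw_seq c1 c2 r m Q :
  exw c1 r m (fun t1 r1 m1 => exw c2 r1 m1 (fun t2 => Q (t1 ++ t2))) ->
  exw (Seq c1 c2) r m Q.
Proof.
case=> t1 [r1 [m1 [h1]]] [t2 [r2 [m2 [h2 h3]]]].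
by exists (t1 ++ t2), r2, m2; split=> //; apply: BsSeq h2.
Qed.

Lemma exw_skip r m (Q : trace -> mapping -> mapping -> Prop) :
  Q [::] r m -> exw Skip r m Q.
Proof. by exists [::], r, m; split=> //; apply: BsSkip. Qed.

Lemma exw_ins i r m (Q : trace -> mapping -> mapping -> Prop) : straight i ->
  Q [:: (emitted i (State 0 r m), accessed i (State 0 r m))]
       (reg (exec w inp i (State 0 r m))) (Defs.mem (exec w inp i (State 0 r m))) ->
  exw (Ins i) r m Q.
Proof. by move=> h1 h2; do 3 eexists; split; first exact: BsIns. Qed.

Lemma exw_if a b c1 c2 r m Q :
  (r a = r b -> exw c1 r m (fun t => Q (nop :: t))) ->
  (r a <> r b -> exw c2 r m (fun t => Q (nop :: rcons t nop))) ->
  exw (IfEq a b c1 c2) r m Q.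
Proof.
move=> h1 h2; case: (r a =P r b) => [e|e].
  have [t [r1 [m1 [h3 h4]]]] := h1 e.
  by exists (nop :: t), r1, m1; split=> //; apply: BsThen.
have [t [r1 [m1 [h3 h4]]]] := h2 e.
by exists (nop :: rcons t nop), r1, m1; split=> //; apply: BsElse.
Qed.

(** The number [N] of rounds is fixed beforehand, which yields termination. The invariant sees the
    whole trace so far; the closing [nop] is the failing test. *)
Lemma exw_while a b c N (I : nat -> trace -> mapping -> mapping -> Prop) r m :
  I 0 [::] r m ->
  (forall j t r m, j < N -> I j t r m ->
    r a <> r b /\ exw c r m (fun t' => I j.+1 (t ++ nop :: rcons t' nop))) ->
  (forall t r m, I N t r m -> r a = r b) ->
  exw (While a b c) r m (fun t r' m' => exists2 t0, t = rcons t0 nop & I N t0 r' m').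
Proof.
move=> I0 IS IN.
suff H j t r1 m1 : j <= N -> I j t r1 m1 ->
  exw (While a b c) r1 m1 (fun t1 r' m' =>
    exists2 t0, t ++ t1 = rcons t0 nop & I N t0 r' m') by exact: (H 0 [::]).
move jN: (N - j) => k; elim: k j t r1 m1 jN => [|k IH] j t r1 m1 jN lejN Ij.
  have ejN : j = N by apply/eqP; rewrite eqn_leq lejN -subn_eq0 jN.
  rewrite {}ejN in Ij; exists [:: nop], r1, m1; split.
    exact/BsStop/(IN t r1 m1 Ij).
  by exists t; rewrite ?cats1.
have ltjN : j < N by rewrite -subn_gt0 jN.
have [ne [t1 [r2 [m2 [h1 h2]]]]] := IS _ _ _ _ ltjN Ij.
have [|t2 [r3 [m3 [h3 [t3 e3 h4]]]]] := IH _ _ _ _ _ ltjN h2; first lia.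
exists (nop :: rcons t1 nop ++ t2), r3, m3; split.
  exact: BsLoop h3.
by exists t3; rewrite // -e3 /= -catA.
Qed.

End Semantics.

(** * Delay of a trace *)

(* [c] is the number of steps since the last output when [tr] starts, [idle c tr] when it ends. *)
Fixpoint okgap (B c : nat) (tr : trace) : bool :=
  (c <= B) && (if tr is e :: tr' then okgap B (if e.1 is Some _ then 0 else c.+1) tr' else true).

Fixpoint idle (c : nat) (tr : trace) : nat :=
  if tr is e :: tr' then idle (if e.1 is Some _ then 0 else c.+1) tr' else c.

Definition paced (B c : nat) (tr : trace) (c' : nat) : Prop :=
  okgap B c tr /\ idle c tr <= c'.

Lemma idle_leq c c' tr : c <= c' -> idle c tr <= idle c' tr.
Proof. by elim: tr c c' => //= -[[o|] a] tr IH c c' le; apply: IH. Qed.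

Lemma okgap_leq B c c' tr : c <= c' -> okgap B c' tr -> okgap B c tr.
Proof.
elim: tr c c' => [|[[o|] a] tr IH] c c' le /= /andP[le2 ok].
- by rewrite (leq_trans le).
- by rewrite (leq_trans le).
- by rewrite (leq_trans le) // (IH _ c'.+1).
Qed.

Lemma paced_cat B c t1 c1 t2 c2 :
  paced B c t1 c1 -> paced B c1 t2 c2 -> paced B c (t1 ++ t2) c2.
Proof.
case=> h1 h2 [/(okgap_leq h2) h3 h4]; have := leq_trans (idle_leq t2 h2) h4.
rewrite /paced {h2 h4}; elim: t1 c h1 h3 => [|[[o|] a] t1 IH] c //= /andP[-> h1] h3 h4; exact: IH.
Qed.

Lemma paced_size B c tr c' : c + size tr <= c' -> c' <= B -> paced B c tr c'.
Proof.
rewrite /paced; elim: tr c => [|[[o|] a] tr IH] c /= h1 h2.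
- by rewrite addn0 in h1; rewrite (leq_trans h1 h2) h1.
- have [||-> ->] := IH 0; rewrite ?andbT //; lia.
- have [||-> ->] := IH c.+1; rewrite ?andbT //; lia.
Qed.

(** The position of the output inside [tr] is not tracked, so the full length is charged both to the
    gap before it and to the idle time after it. *)
Lemma paced_out B c tr c' :
  outs tr <> [::] -> c + size tr <= B -> size tr <= c' -> paced B c tr c'.
Proof.
rewrite /paced; elim: tr c => [|[[o|] a] tr IH] c //= h1 h2 h3.
- have [||h4 h5] := @paced_size (maxn B c') 0 tr c'; try lia.
  have [|//|h6 h7] := @paced_size B 0 tr B; first lia.
  rewrite h5 h6 andbT; split=> //; lia.
- have [||-> ->] := IH c.+1 h1; rewrite ?andbT; lia.
Qed.

Section Link.
Variables (w : nat) (P : program) (inp mem0 : nat -> nat).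
Notation run := (run w P inp mem0).
Notation instr_at := (instr_at w P inp mem0).
Notation emitted_at := (emitted_at w P inp mem0).

Lemma follows_run t tr s : follows w inp P (run t) tr s ->
  [/\ run (t + size tr) = s,
      [seq (emitted_at i, accessed (instr_at i) (run i)) | i <- iota t (size tr)] = tr
    & forall i, t <= i < t + size tr -> ~~ is_halt (instr_at i)].
Proof.
elim: tr t => [|e tr IH] t /=.
  by move=> <-; rewrite addn0; split=> // i; rewrite ltnNge andbN.
case=> h1 -> h2.
have rS : run t.+1 = exec w inp (fetch P (run t)) (run t) by [].
rewrite -rS in h2; have [e1 e2 e3] := IH _ h2.
rewrite addnS -addSn; split=> //; first by rewrite e2.
move=> i /andP[]; rewrite leq_eqVlt => /orP[/eqP <- _|h3 h4]; first by [].
by apply: e3; rewrite h3.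
Qed.

(** At most [B] silent instructions precede an event, and the instruction of the event itself takes
    one more time unit, hence [B.+1]. The last entry is the completion of [Halt]. *)
Lemma gaps_leq B tr t c : okgap B c tr -> c <= t ->
  [seq emitted_at i | i <- iota t (size tr)] = map fst tr ->
  all (fun d => d <= B.+1) (pairmap (fun x y => y - x) (t - c)
    (rcons [seq i.+1 | i <- iota t (size tr) & isSome (emitted_at i)] (t + size tr).+1)).
Proof.
elim: tr t c => [|[o a] tr IH] t c /=.
  by rewrite andbT addn0 => h1 h2 _; rewrite andbT; lia.
case/andP=> h1 h2 h3 [eo em]; rewrite eo; case: o h2 {eo} => [o|] h2 /=.
- have := IH t.+1 0 h2 isT em; rewrite subn0 addSn addnS => ->; rewrite andbT; lia.
- have := IH t.+1 c.+1 h2 h3 em; by rewrite subSS addSn addnS.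
Qed.

Lemma follows_halt B tr s :
  follows w inp P (State 0 (fun=> 0) mem0) tr s -> fetch P s = Halt -> okgap B 0 tr ->
  [/\ halts_at w P inp mem0 (size tr), outputs w P inp mem0 (size tr) = outs tr,
      delay w P inp mem0 (size tr) <= B.+1
    & accesses w P inp mem0 (size tr) = accs tr].
Proof.
move=> fol fs ok.
have [e1 e2 e3] := @follows_run 0 tr s fol; rewrite add0n in e1 e3.
have e4 : [seq emitted_at i | i <- iota 0 (size tr)] = map fst tr.
  by rewrite -[RHS](congr1 (map fst) e2) -map_comp.
split.
- by split; [rewrite /Defs.instr_at e1 fs | move=> t lt; apply: e3].
- rewrite /outputs /outs -[tr in RHS]e2.
  by elim: (iota _ _) => //= i l <-.
- have := gaps_leq ok (leqnn 0) e4; rewrite add0n => /allP h.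
  by rewrite /delay; apply/bigmax_leqP_seq => i hi _; apply: h.
- rewrite /accesses /accs -[tr in RHS]e2 -map_comp.
  by congr flatten.
Qed.

End Link.

(** * Breadth-first search *)

Lemma has_walk0 (T : finType) (E : rel T) u : has_walk E u u 0.
Proof. by apply/existsP; exists [tuple]; rewrite /= eqxx. Qed.

Lemma has_walk0E (T : finType) (E : rel T) u v : has_walk E u v 0 -> v = u.
Proof. by case/existsP=> p; rewrite tuple0 /= => /eqP. Qed.

Lemma has_walkS (T : finType) (E : rel T) u v x k :
  has_walk E u v k -> E v x -> has_walk E u x k.+1.
Proof.
case/existsP=> p /andP[pp /eqP ev] vx; apply/existsP.
exists [tuple of rcons p x]; rewrite /= rcons_path pp last_rcons eqxx andbT.
by rewrite -ev vx.
Qed.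

Lemma has_walk_connect (T : finType) (E : rel T) u v k :
  has_walk E u v k -> connect E u v.
Proof. by case/existsP=> p /andP[pp /eqP ev]; apply/connectP; exists p. Qed.

Lemma has_walkSE (T : finType) (E : rel T) u x k :
  has_walk E u x k.+1 -> exists2 v, has_walk E u v k & E v x.
Proof.
case/existsP=> p; case: p => p /=; case/lastP: p => [//|p y].
rewrite size_rcons eqSS => sp /andP[]; rewrite rcons_path last_rcons.
move=> /andP[pp Ey] /eqP ->; exists (last u p) => //.
by apply/existsP; exists (Tuple sp); rewrite /= pp eqxx.
Qed.

(** Eliminator for [dist], whose definition matches on a proof of connectedness; later arguments
    only use minimality among walk lengths. *)
Lemma dist_ind (T : finType) (E : rel T) u v (Q : option nat -> Prop) :
  (~ connect E u v -> Q None) ->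
  (forall k, has_walk E u v k -> (forall j, has_walk E u v j -> k <= j) -> Q (Some k)) ->
  Q (dist E u v).
Proof.
move=> h1 h2; rewrite /dist; move: (@idP (connect E u v)).
case: {-1}_ / => [uv|//]; case: ex_minnP => k; exact: h2.
Qed.

Lemma dist_none (T : finType) (E : rel T) u v : ~~ connect E u v -> dist E u v = None.
Proof.
move/negP=> h; apply: (@dist_ind _ E u v (fun o => o = None)) => // k.
by move/has_walk_connect.
Qed.

Lemma dist_some (T : finType) (E : rel T) u v k :
  has_walk E u v k -> (forall j, has_walk E u v j -> k <= j) -> dist E u v = Some k.
Proof.
move=> h1 h2; apply: (@dist_ind _ E u v (fun o => o = Some k)) => [|j h3 h4].
  by case; apply: has_walk_connect h1.
by congr Some; apply/eqP; rewrite eqn_leq h4 //= h2.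
Qed.

Section Bfs.
Variables (n : nat) (E : rel 'I_n) (s : 'I_n).

(* [Q] lists the discovered vertices, of which the first [h] are dequeued;    *)
(* [rest] is the unread part of the list of the last of these, and [d] its    *)
(* distance plus one. [D v = n] stands for undiscovered.                      *)
Record bfs_inv (D : 'I_n -> nat) (Q : seq 'I_n) (h : nat) (rest : seq 'I_n) (d : nat)
  : Prop := BfsInv {
  bfs_uniq : uniq Q;
  bfs_src : s \in Q /\ D s = 0;
  bfs_undisc : forall v, (D v == n) = (v \notin Q);
  bfs_walk : forall v, v \in Q -> has_walk E s v (D v);
  bfs_bound : forall j, j < size Q -> D (nth s Q j) <= j;
  bfs_mono : forall i j, i <= j < size Q -> D (nth s Q i) <= D (nth s Q j);
  bfs_front : forall v, v \in Q -> D v <= d;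
  bfs_edges : forall j v, j < h -> E (nth s Q j) v ->
     (v \in Q) && (D v <= (D (nth s Q j)).+1) || (j.+1 == h) && (v \in rest);
  bfs_rest : if h is h'.+1 then
       d = (D (nth s Q h')).+1 /\ {subset rest <= E (nth s Q h')}
     else rest = [::] /\ d = 0;
  bfs_head : h <= size Q }.

Definition bfs_start (v : 'I_n) : nat := if v == s then 0 else n.

Lemma bfs_inv_start : bfs_inv bfs_start [:: s] 0 [::] 0.
Proof.
have n0 : 0 < n := leq_ltn_trans (leq0n s) (ltn_ord s).
split=> //.
- by rewrite mem_seq1 eqxx /bfs_start eqxx.
- by move=> v; rewrite mem_seq1 /bfs_start; case: (v == s); rewrite ?eqxx //; lia.
- by move=> v; rewrite mem_seq1 => /eqP ->; rewrite /bfs_start eqxx; apply: has_walk0.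
- by case=> //= _; rewrite /bfs_start eqxx.
- move=> i j /= /andP[le lt]; by have -> : i = j by lia.
- by move=> v; rewrite mem_seq1 => /eqP ->; rewrite /bfs_start eqxx.
Qed.

(** Distances increase along the queue, so the new [d], one more than that of the dequeued vertex,
    still bounds every discovered distance. *)
Lemma bfs_inv_pop D Q h d adj :
  bfs_inv D Q h [::] d -> h < size Q -> adj =i E (nth s Q h) ->
  bfs_inv D Q h.+1 adj (D (nth s Q h)).+1.
Proof.
case=> i1 i2 i3 i4 i5 i6 i7 i8 i9 i10 lt adjE; split=> //.
- move=> v vQ; apply: leq_trans (i7 v vQ) _.
  case: h i8 i9 i10 lt adjE => [|h] i8 i9 i10 lt adjE; first by case: i9 => _ ->.
  by case: i9 => -> _; rewrite ltnS; apply: i6; lia.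
- move=> j v; rewrite ltnS leq_eqVlt => /orP[/eqP->|lt1] Ev.
    by rewrite eqxx adjE; apply/orP; right.
  have /orP[->//|] := i8 j v lt1 Ev.
  by rewrite in_nil andbF.
- by split=> // v; rewrite adjE.
Qed.

(** The edge to [v] is settled because all discovered distances are at most [d], the distance of the
    dequeued vertex plus one. *)
Lemma bfs_inv_old D Q h d v rest :
  bfs_inv D Q h (v :: rest) d -> v \in Q -> bfs_inv D Q h rest d.
Proof.
case=> i1 i2 i3 i4 i5 i6 i7 i8 i9 i10 vQ; split=> //.
- move=> j x ltj Ex; have := i8 j x ltj Ex; case/orP=> [->//|/andP[/eqP e]].
  rewrite inE => /orP[/eqP ->|->]; last by rewrite e eqxx orbT.
  rewrite vQ /=; apply/orP; left; case: h e i9 {i8 i10 ltj} => // h [->] [<- _]; exact: i7.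
- case: h i9 {i8 i10} => [|h] [h1 h2] //; split=> // x xr; apply: h2.
  by rewrite inE xr orbT.
Qed.

Lemma bfs_inv_new (D D' : 'I_n -> nat) Q h d v rest :
  bfs_inv D Q h (v :: rest) d -> v \notin Q ->
  (forall x, D' x = if x == v then d else D x) ->
  size Q < n /\ bfs_inv D' (rcons Q v) h rest d.
Proof.
case=> i1 i2 i3 i4 i5 i6 i7 i8 i9 i10 vQ D'E.
have uQ : uniq (rcons Q v) by rewrite rcons_uniq vQ.
have ltQ : size Q < n.
  by have := card_uniqP uQ; rewrite size_rcons => <-; rewrite -[leqRHS]card_ord max_card.
have hpos : 0 < h by case: (h) i9 => // -[].
have D'Q x : x \in Q -> D' x = D x.
  by move=> xQ; rewrite D'E; case: eqP => // e; rewrite -e xQ in vQ.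
have nthQ j : j < size Q -> nth s (rcons Q v) j = nth s Q j.
  by move=> lt; rewrite nth_rcons lt.
(* A distance is at most the queue position, so [d <= h <= size Q < n]: the new entry cannot be
   confused with the marker [n]. *)
have dh : d <= h.
  case: (h) hpos i9 i10 => // k _ [-> _] lt; exact: i5.
have D'n j : j < size Q -> D' (nth s (rcons Q v) j) = D (nth s Q j).
  by move=> lt; rewrite nthQ // D'Q ?mem_nth.
have D'v : D' v = d by rewrite D'E eqxx.
have nthv : nth s (rcons Q v) (size Q) = v by rewrite nth_rcons ltnn eqxx.
split=> //; split=> //.
- by rewrite mem_rcons inE i2.1 orbT D'Q ?i2.1 ?i2.2.
- move=> x; rewrite D'E mem_rcons inE negb_or; case: (x == v) => //=.
  by apply/negbTE/eqP; lia.
- move=> x; rewrite mem_rcons inE D'E; case: eqP => [->|_] /= xQ; last exact: i4.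
  case: (h) hpos i9 i10 => // k _ [-> sub] lt.
  apply: has_walkS (i4 _ (mem_nth s lt)) _; apply: sub; exact: mem_head.
- move=> j; rewrite size_rcons ltnS leq_eqVlt => /orP[/eqP ->|lt].
    rewrite nthv D'v; exact: leq_trans i10.
  by rewrite D'n //; apply: i5.
- move=> i j; rewrite size_rcons ltnS => /andP[le]; rewrite leq_eqVlt.
  case/orP=> [/eqP ej|lt]; last by rewrite !D'n ?(leq_ltn_trans le) //; apply: i6; rewrite le.
  subst j; rewrite nthv D'v.
  move: le; rewrite leq_eqVlt => /orP[/eqP ->|lt]; first by rewrite nthv D'v.
  by rewrite D'n //; apply: i7; rewrite mem_nth.
- move=> x; rewrite mem_rcons inE => /orP[/eqP->|xQ]; first by rewrite D'v.
  by rewrite D'Q //; apply: i7.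
- move=> j x ltj; have ltj' := leq_trans ltj i10.
  rewrite nthQ // => Ex; rewrite (D'Q (nth s Q j)) ?mem_nth //.
  have /orP[/andP[xQ le]|/andP[/eqP e]] := i8 j x ltj Ex.
    by rewrite (D'Q x) // mem_rcons inE xQ orbT le.
  rewrite inE => /orP[/eqP ->|->]; last by rewrite e eqxx orbT.
  rewrite mem_rcons inE eqxx D'v /=; apply/orP; left.
  by case: (h) e i9 => // k [->] [-> _].
- case: (h) hpos i9 i10 => // k _ [-> sub] lt; rewrite nthQ // D'Q ?mem_nth //.
  by split=> // x xr; apply: sub; rewrite inE xr orbT.
- by rewrite size_rcons; lia.
Qed.

(** With the queue exhausted, every edge out of a discovered vertex raises [D] by at most one. By
    induction, a walk of length k ends in [Q] with [D] at most k; conversely each [D v] is the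
    length of a walk. *)
Lemma bfs_inv_dist D Q d v :
  bfs_inv D Q (size Q) [::] d ->
  dist E s v = if D v == n then None else Some (D v).
Proof.
case=> i1 i2 i3 i4 i5 i6 i7 i8 i9 i10.
have step u x : u \in Q -> E u x -> (x \in Q) && (D x <= (D u).+1).
  move=> uQ; have := i8 (index u Q) x; rewrite index_mem uQ nth_index // => h /(h isT).
  by rewrite in_nil andbF orbF.
have walk k x : has_walk E s x k -> (x \in Q) && (D x <= k).
  elim: k x => [|k IH] x; first by move/has_walk0E ->; rewrite i2.1 i2.2.
  case/has_walkSE=> u /IH/andP[uQ le] /(step u x uQ) /andP[-> le2] /=; lia.
case: eqP => [Dn|/eqP Dn].
  apply: dist_none; apply/negP=> /connect_has_walk[k /walk/andP[vQ _]].
  by move: (i3 v); rewrite Dn eqxx vQ.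
have vQ : v \in Q by move: (i3 v) Dn => ->; rewrite negbK.
by apply: dist_some (i4 v vQ) _ => j /walk/andP[].
Qed.

End Bfs.

(** * The program *)

Fixpoint block (s : seq cmd) : cmd :=
  match s with
  | [::] => Skip
  | [:: c] => c
  | c :: s' => Seq c (block s')
  end.

Notation Plus a b c := (Ins (Op BAdd a b c)).
Notation Minus a b c := (Ins (Op BSub a b c)).

(* Registers: 0, 1, 2 hold n, 1, 0; 3 and 4 the source u and its partner f u, *)
(* with 5 telling whether (u, f u) is an edge; 7, 8, 9 are used to sum        *)
(* degrees; 10 is the budget K. Search: 12 source, 13 number of table entries *)
(* still to initialise, 14 and 15 queue head and tail, 16 pointer into the    *)
(* current list, 17 distance plus one of the dequeued vertex, 18 base of the  *)
(* table, 19 start of the queue. 24 is n + 1; 25 the base of the table being  *)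
(* output and 26 the target; the others are temporaries. Memory: two distance *)
(* tables at offsets 0 and n, indexed from 1, then the queue at 2n + 1.       *)
Definition scan_list : cmd :=
  IfEq 6 2 Skip (block
    [:: Ins (ReadInp 4 6);
        IfEq 4 3 (block
          [:: Plus 6 6 1; Ins (ReadInp 6 6); IfEq 6 2 Skip (Ins (ReadInp 4 6))])
          Skip]).

Definition first_neighbour : cmd := block
  [:: Plus 4 3 2; Plus 6 0 3; Ins (ReadInp 6 6);
      scan_list;
      IfEq 4 3
        (Seq (Ins (Const 5 0)) (IfEq 3 1 (Ins (Const 4 2)) (Ins (Const 4 1))))
        (Ins (Const 5 1))].

Definition emit_first : cmd :=
  Seq first_neighbour (IfEq 5 1 (Ins (Out 3 4 1)) (Ins (OutInf 3 4))).

Definition bfs_begin : cmd := block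
  [:: Plus 13 0 2; Plus 14 19 2; Plus 15 19 1; Ins (Const 16 0); Ins (Const 17 0);
      Ins (StoreMem 19 12)].

(** There is no loop here: a step clears one table entry, dequeues one vertex or reads one list
    cell, and does nothing once the search is over. *)
Definition bfs_step : cmd :=
  IfEq 13 2
    (IfEq 16 2
       (IfEq 14 15 Skip (block
          [:: Ins (LoadMem 20 14); Plus 14 14 1; Plus 21 18 20; Ins (LoadMem 17 21);
              Plus 17 17 1; Plus 21 0 20; Ins (ReadInp 16 21)]))
       (block
          [:: Ins (ReadInp 20 16); Plus 16 16 1; Ins (ReadInp 16 16); Plus 21 18 20;
              Ins (LoadMem 22 21);
              IfEq 22 0 (block
                [:: Ins (StoreMem 21 17); Ins (StoreMem 15 20); Plus 15 15 1])
                Skip]))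
    (block
       [:: Plus 21 18 13; IfEq 13 12 (Ins (StoreMem 21 2)) (Ins (StoreMem 21 0));
           Minus 13 13 1]).

Definition bfs_run : cmd :=
  Seq (Plus 23 10 2) (While 23 2 (Seq bfs_step (Minus 23 23 1))).

(** * Rules for single instructions, free of overflow *)

Section Rules.
Variables (w : nat) (inp : nat -> nat).
Local Notation exw := (exw w inp).

Lemma exw_const a c r m (Q : trace -> mapping -> mapping -> Prop) :
  c < 2 ^ w -> Q [:: nop] (upd r a c) m -> exw (Ins (Const a c)) r m Q.
Proof. by move=> h1 h2; apply: exw_ins => //=; rewrite modn_small. Qed.

Lemma exw_add v a b c r m (Q : trace -> mapping -> mapping -> Prop) :
  r b + r c = v -> v < 2 ^ w -> Q [:: nop] (upd r a v) m ->
  exw (Ins (Op BAdd a b c)) r m Q.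
Proof. by move=> h1 h2 h3; apply: exw_ins => //=; rewrite /binop_eval h1 modn_small. Qed.

Lemma exw_sub v a b c r m (Q : trace -> mapping -> mapping -> Prop) :
  r b = v + r c -> r b < 2 ^ w -> Q [:: nop] (upd r a v) m ->
  exw (Ins (Op BSub a b c)) r m Q.
Proof.
move=> h1 h2 h3; apply: exw_ins => //=; rewrite /binop_eval.
have -> : r b + (2 ^ w - r c) = v + 2 ^ w by lia.
by rewrite modnDr modn_small //; lia.
Qed.

Lemma exw_mul v a b c r m (Q : trace -> mapping -> mapping -> Prop) :
  r b * r c = v -> v < 2 ^ w -> Q [:: nop] (upd r a v) m ->
  exw (Ins (Op BMul a b c)) r m Q.
Proof. by move=> h1 h2 h3; apply: exw_ins => //=; rewrite /binop_eval h1 modn_small. Qed.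

Lemma exw_div v a b c r m (Q : trace -> mapping -> mapping -> Prop) :
  r b %/ r c = v -> v < 2 ^ w -> Q [:: nop] (upd r a v) m ->
  exw (Ins (Op BDiv a b c)) r m Q.
Proof. by move=> h1 h2 h3; apply: exw_ins => //=; rewrite /binop_eval h1 modn_small. Qed.

Lemma exw_shr v a b c r m (Q : trace -> mapping -> mapping -> Prop) :
  r b %/ 2 ^ r c = v -> v < 2 ^ w -> Q [:: nop] (upd r a v) m ->
  exw (Ins (Op BShr a b c)) r m Q.
Proof. by move=> h1 h2 h3; apply: exw_ins => //=; rewrite /binop_eval h1 modn_small. Qed.

Lemma exw_load x a b r m (Q : trace -> mapping -> mapping -> Prop) :
  r b = x -> Q [:: (None, [:: x])] (upd r a (m x)) m -> exw (Ins (LoadMem a b)) r m Q.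
Proof. by move=> <- h; apply: exw_ins. Qed.

Lemma exw_store x y a b r m (Q : trace -> mapping -> mapping -> Prop) :
  r a = x -> r b = y -> Q [:: (None, [:: x])] r (upd m x y) ->
  exw (Ins (StoreMem a b)) r m Q.
Proof. by move=> <- <- h; apply: exw_ins. Qed.

Lemma exw_read x a b r m (Q : trace -> mapping -> mapping -> Prop) :
  r b = x -> Q [:: nop] (upd r a (inp x)) m -> exw (Ins (ReadInp a b)) r m Q.
Proof. by move=> <- h; apply: exw_ins. Qed.

End Rules.

Definition degree_phase : cmd := block
  [:: Plus 3 1 2; Plus 7 0 2; Ins (Const 8 0); Plus 9 0 1; Ins (Op BShr 9 9 1);
      Plus 9 9 1;
      While 3 9 (block
        [:: emit_first; Ins (ReadInp 28 3); Plus 8 8 28; Ins (ReadInp 28 7);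
            Plus 8 8 28; Plus 3 3 1; Minus 7 7 1])].

Definition set_budget : cmd := block
  [:: Ins (Op BDiv 10 8 0); Ins (Const 11 3); Ins (Op BMul 10 10 11);
      Ins (Const 11 9); Plus 10 10 11; Plus 12 1 2; Ins (Const 18 0); Plus 19 0 0;
      Plus 19 19 1; Plus 24 0 1].

Definition first_phase : cmd :=
  Seq bfs_begin (While 3 24 (block [:: emit_first; Plus 3 3 1; bfs_run])).

Definition slot : cmd := block
  [:: Plus 28 25 26; Ins (LoadMem 27 28);
      IfEq 26 3 Skip (IfEq 26 4 Skip
        (IfEq 27 0 (Ins (OutInf 3 26)) (Ins (Out 3 26 27))));
      Plus 26 26 1; bfs_run].

(* In the phase of the last source, which has no successor, the search is     *)
(* pointlessly run again from that source.                                    *)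
Definition source_phase : cmd := block
  [:: first_neighbour; Plus 25 18 2; Minus 18 0 18; IfEq 12 0 Skip (Plus 12 12 1);
      bfs_begin; Plus 26 1 2; While 26 24 slot; Plus 3 3 1].

(** For n = 1 there is nothing to output; the single store is there so that n words are used in that
    case too. *)
Definition apsd : cmd := block
  [:: Ins (ReadInp 0 2); Ins (Const 1 1);
      IfEq 0 1 (Ins (StoreMem 2 2)) (block
        [:: degree_phase; set_budget; first_phase; Plus 3 1 2;
            While 3 24 source_phase])].

Lemma take_enum n j (lt : j < n) :
  take j.+1 (enum 'I_n) = rcons (take j (enum 'I_n)) (Ordinal lt).
Proof. rewrite (take_nth (Ordinal lt)) ?size_enum_ord //.
by have /= -> := nth_ord_enum (Ordinal lt) (Ordinal lt). Qed.

(** * Correctness and running time *)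

Section Specs.
Variables (w n : nat) (E : rel 'I_n) (inp : nat -> nat) (adj : 'I_n -> seq 'I_n).
Hypotheses (word_big : 64 * n.+1 ^ 2 <= 2 ^ w)
  (adj_uniq : forall u, uniq (adj u)) (adj_mem : forall u, adj u =i E u)
  (adj_list : forall u : 'I_n,
     linked_list w inp (inp (n + u.+1)) [seq v.+1 | v : 'I_n <- adj u])
  (degree_size : forall u : 'I_n, inp u.+1 = size (adj u))
  (n_gt1 : 1 < n).
Local Notation exw := (exw w inp).

Lemma word_lin : 64 * n.+1 <= 2 ^ w.
Proof. by apply: leq_trans word_big; rewrite leq_mul2l /= -[leqLHS]expn1 leq_pexp2l. Qed.

(** * The search in working memory and its potential *)

Definition consts (r : mapping) := [/\ r 0 = n, r 1 = 1 & r 2 = 0].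

(* The number of steps left, except that vertices that will never be reached are counted. *)
Definition bfs_weight (s : 'I_n) Q h (rest : seq 'I_n) i : nat :=
  i + size rest + \sum_(v | v \notin take h Q) (size (adj v)).+1.

Record bfs_mem (s : 'I_n) (base i h d : nat) (D : 'I_n -> nat) (Q rest : seq 'I_n)
  (r m : mapping) : Prop := BfsMem {
  bm_inv : bfs_inv E s D Q h rest d;
  bm_base : r 18 = base /\ base <= n;
  bm_src : r 12 = s.+1;
  bm_init : r 13 = i /\ i <= n;
  bm_start : 0 < i -> [/\ D =1 bfs_start s, Q = [:: s], h = 0 & rest = [::]];
  bm_head : r 14 = n.*2.+1 + h;
  bm_tail : r 15 = n.*2.+1 + size Q;
  bm_list : linked_list w inp (r 16) [seq v.+1 | v : 'I_n <- rest];
  bm_d : r 17 = d;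
  bm_dist : forall v : 'I_n, i <= v -> m (base + v.+1) = D v;
  bm_queue : forall j, j < size Q -> m (n.*2.+1 + j) = (nth s Q j).+1 }.

(** [k] bounds the remaining steps. Being finished is a separate alternative because unreached
    vertices keep the potential positive. *)
Definition bfs_state s base k r m : Prop :=
  exists i h d D Q rest, bfs_mem s base i h d D Q rest r m /\
   ([/\ i = 0, h = size Q & rest = [::]] \/ bfs_weight s Q h rest i <= k).

Definition bfs_area base x := (base < x <= base + n) || (n.*2 < x <= n.*2 + n).

Lemma bfs_step_spec s base k r m : consts r -> bfs_state s base k r m ->
  exw bfs_step r m (fun t r' m' =>
   [/\ bfs_state s base k.-1 r' m', outs t = [::], size t <= 20 &
       all (bfs_area base) (accs t)]).
Proof.
have wl := word_lin.
move=> [R0 R1 R2] [i [h [d [D [Q [rest [[inv [R18 lb] R12 [R13 li] st R14 R15 lst R17 md mq] alt]]]]]]].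
have hQ := bfs_head inv; have Qn : size Q <= n.
  by rewrite -(card_uniqP (bfs_uniq inv)) -[leqRHS]card_ord max_card.
apply: exw_if => [e13|e13].
  have i0 : i = 0 by lia.
  rewrite {i}i0 in R13 li st md alt *; apply: exw_if => [e16|e16].
    have rnil : rest = [::].
      by case: (rest) lst => // v l [h1 _ _ _]; lia.
    subst rest.
    apply: exw_if => [e1415|e1415].
      have hs : h = size Q by lia.
      apply: exw_skip; split=> //=.
      by exists 0, h, d, D, Q, [::]; split; [split|left].
    have hs : h < size Q by lia.
    set u := nth s Q h.
    have un := ltn_ord u.
    have mu : m (n.*2.+1 + h) = u.+1 by exact: mq.
    have mD : m (base + u.+1) = D u by exact: md.
    have Du : D u <= h by exact: (bfs_bound inv).
    apply: exw_seq; apply: exw_load; first exact: R14.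
    rewrite mu.
    apply: exw_seq; apply: (@exw_add w inp (n.*2.+1 + h.+1)); [rewrite /upd /=; lia|lia|].
    apply: exw_seq; apply: (@exw_add w inp (base + u.+1)); [rewrite /upd /=; lia|lia|].
    apply: exw_seq; apply: (@exw_load w inp (base + u.+1)); first by [].
    rewrite mD.
    apply: exw_seq; apply: (@exw_add w inp ((D u).+1)); [rewrite /upd /=; lia|lia|].
    apply: exw_seq; apply: (@exw_add w inp (n + u.+1)); [rewrite /upd /=; lia|lia|].
    apply: (@exw_read w inp (n + u.+1)); first by [].
    split=> //=; last by rewrite /bfs_area; lia.
    exists 0, h.+1, (D u).+1, D, Q, (adj u); split.
      split=> //; rewrite /upd /=.
      - by apply: bfs_inv_pop (inv) _ _.
      - exact: adj_list.
    (* Dequeuing [u] trades its share deg(u) + 1 of the potential for deg(u) unread cells. *)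
    right; case: alt => [[_ hh]|]; first lia.
    rewrite /bfs_weight /= !add0n (take_nth s hs) -/u => lek.
    have unot : u \notin take h Q.
      have : uniq (take h Q ++ drop h Q) by rewrite cat_take_drop (bfs_uniq inv).
      rewrite cat_uniq => /and3P[_ /hasPn nh _].
      by apply: nh; rewrite (drop_nth s hs) mem_head.
    rewrite (bigD1 u) //= in lek.
    rewrite [X in _ + X](eq_bigl (fun v => (v \notin take h Q) && (v != u))).
      by move: lek; move: (\sum_(_ < n | _) _) => S; lia.
    by move=> v; rewrite mem_rcons inE negb_or andbC.
  case: rest lst inv st alt => [|v rest] lst inv st alt.
    by case: e16; rewrite R2; exact: lst.
  case: lst => /= p0 pw pv lst.
  have vn := ltn_ord v.
  have mD : m (base + v.+1) = D v by exact: md.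
  have hk : bfs_weight s Q h (v :: rest) 0 <= k by case: alt => // -[].
  have wt : bfs_weight s Q h rest 0 <= k.-1.
    by move: hk; rewrite /bfs_weight /=; lia.
  apply: exw_seq; apply: (@exw_read w inp (r 16)); first by [].
  rewrite pv.
  apply: exw_seq; apply: (@exw_add w inp ((r 16).+1)); [rewrite /upd /=; lia|lia|].
  apply: exw_seq; apply: (@exw_read w inp ((r 16).+1)); first by [].
  apply: exw_seq; apply: (@exw_add w inp (base + v.+1)); [rewrite /upd /=; lia|lia|].
  apply: exw_seq; apply: (@exw_load w inp (base + v.+1)); first by [].
  rewrite mD; apply: exw_if; rewrite /upd /= R0 => eD.
    have vQ : v \notin Q by rewrite -(bfs_undisc inv) eD.
    set D' := fun x => if x == v then d else D x.
    have [sQ inv'] := @bfs_inv_new _ _ _ _ D' _ _ _ _ _ inv vQ (fun=> erefl).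
    apply: exw_seq; apply: (@exw_store w inp (base + v.+1) d); [by []|by []|].
    apply: exw_seq; apply: (@exw_store w inp (n.*2.+1 + size Q) v.+1); [by []|by []|].
    apply: (@exw_add w inp (n.*2.+1 + (size Q).+1)); [rewrite /upd /=; lia|lia|].
    split=> //=; last by rewrite /bfs_area; lia.
    exists 0, h, d, D', (rcons Q v), rest; split.
      split=> //; rewrite /upd /= ?size_rcons //.
      - move=> x _; have xn := ltn_ord x; rewrite ifN; last by apply/eqP; lia.
        rewrite /D' eqn_add2l eqSS; case: eqP => [/val_inj ->|ne]; first by rewrite eqxx.
        by rewrite md //; case: eqP => // xe; rewrite xe in ne.
      - move=> j; rewrite ltnS leq_eqVlt => /orP[/eqP->|lt].
          by rewrite eqxx nth_rcons ltnn eqxx.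
        rewrite nth_rcons lt ifN; last by apply/eqP; lia.
        by rewrite ifN ?mq //; apply/eqP; lia.
    (* Discovery appends at the tail, so the dequeued prefix is unchanged; the unit of potential is
       paid by the cell just read. *)
    right; move: wt; rewrite /bfs_weight.
    by rewrite -cats1 takel_cat.
  apply: exw_skip; split=> //=; last by rewrite /bfs_area; lia.
  have vQ : v \in Q by rewrite -[_ \in _]negbK -(bfs_undisc inv); apply/eqP.
  exists 0, h, d, D, Q, rest; split; last by right.
  by split=> //; apply: bfs_inv_old vQ.
have ip : 0 < i by lia.
have [Ds Qs h0 rest0] := st ip; subst Q h rest.
have lei : i.-1 < n by lia.
set v := Ordinal lei.
have Dv : D v = if i == s.+1 then 0 else n.
  by rewrite Ds /bfs_start -val_eqE /= -eqSS prednK.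
apply: exw_seq; apply: (@exw_add w inp (base + i)); [lia|lia|].
apply: exw_seq.
have H (r1 := upd r 21 (base + i)) :
  exw (IfEq 13 12 (Ins (StoreMem 21 2)) (Ins (StoreMem 21 0))) r1 m (fun t r2 m2 =>
    [/\ r2 = r1, m2 = upd m (base + i) (D v), outs t = [::], size t <= 3 &
        accs t = [:: base + i]]).
  apply: exw_if; rewrite /r1 /upd /= => e.
    apply: (@exw_store w inp (base + i) 0); [by []|by []|]; split=> //=.
    by rewrite Dv ifT //; apply/eqP; lia.
  apply: (@exw_store w inp (base + i) n); [by []|by []|]; split=> //=.
  by rewrite Dv ifF //; apply/eqP; lia.
apply: exw_conseq H _ => t r1 m1 [-> -> ot sz at1].
apply: (@exw_sub w inp i.-1); [rewrite /upd /=; lia|rewrite /upd /=; lia|].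
split.
- exists i.-1, 0, d, D, [:: s], [::]; split; last first.
    by right; case: alt => [[]|]; rewrite /bfs_weight /=; lia.
  split=> //; rewrite /upd /=; try lia; try by [].
  - move=> x lex; have xn := ltn_ord x.
    case: eqP => [e|ne]; last by apply: md; lia.
    by congr D; apply: val_inj => /=; lia.
  - by move=> j lej; have sn := ltn_ord s; rewrite ifN ?mq //; apply/eqP; lia.
- by rewrite !outsE ot.
- by rewrite /= size_rcons /= size_cat /=; lia.
- by rewrite !accsE at1 /= andbT /bfs_area; lia.
Qed.

Lemma bfs_state_ext s base k r m r' m' :
  bfs_state s base k r m -> (forall a, 12 <= a <= 18 -> r' a = r a) ->
  (forall x, bfs_area base x -> m' x = m x) -> bfs_state s base k r' m'.
Proof.
case=> i [h [d [D [Q [rest [[inv R18 R12 R13 st R14 R15 lst R17 md mq] alt]]]]]] er em.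
have Qn : size Q <= n.
  by rewrite -(card_uniqP (bfs_uniq inv)) -[leqRHS]card_ord max_card.
exists i, h, d, D, Q, rest; split=> //; split; rewrite ?er //.
- by move=> v lv; rewrite em ?md // /bfs_area; have := ltn_ord v; lia.
- by move=> j lj; rewrite em ?mq // /bfs_area; lia.
Qed.

(** Zero potential leaves no entry to clear, no cell to read and no vertex outside the dequeued
    prefix. That n is never a finite distance is what lets it be decoded as infinity. *)
Lemma bfs_state_done s base r m : bfs_state s base 0 r m ->
  forall v : 'I_n, m (base + v.+1) = odflt n (dist E s v) /\ dist E s v != Some n.
Proof.
case=> i [h [d [D [Q [rest [[inv R18 R12 [R13 _] st R14 R15 lst R17 md mq] alt]]]]]] v.
have [i0 hQ rest0] : [/\ i = 0, h = size Q & rest = [::]].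
  case: alt => //; rewrite leqn0 /bfs_weight addn_eq0 => /andP[].
  rewrite addn_eq0 => /andP[/eqP -> /nilP ->] /eqP h0; split=> //.
  apply/eqP; rewrite eqn_leq (bfs_head inv) leqNgt; apply/negP => lt.
  have u_in : nth s Q h \notin take h Q.
    have : uniq (take h Q ++ drop h Q) by rewrite cat_take_drop (bfs_uniq inv).
    rewrite cat_uniq => /and3P[_ /hasPn nh _]; apply: nh.
    by rewrite (drop_nth s lt) mem_head.
  by move: h0; rewrite (bigD1 (nth s Q h)).
subst h rest; rewrite md ?i0 // (bfs_inv_dist v inv).
by case: eqP => [->|/eqP ne] /=.
Qed.

Definition bfs_work : nat := n + \sum_(v < n) (size (adj v)).+1.

Lemma bfs_begin_spec (s : 'I_n) base r m : consts r -> r 12 = s.+1 -> r 18 = base ->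
  base <= n -> r 19 = n.*2.+1 ->
  exw bfs_begin r m (fun t r' m' => [/\ bfs_state s base bfs_work r' m',
    outs t = [::], size t <= 6 & all (bfs_area base) (accs t)]).
Proof.
move=> [R0 R1 R2] R12 R18 lb R19.
have wl := word_lin; have sn := ltn_ord s.
apply: exw_seq; apply: (@exw_add w inp n); [rewrite /upd /=; lia|lia|].
apply: exw_seq; apply: (@exw_add w inp n.*2.+1); [rewrite /upd /=; lia|lia|].
apply: exw_seq; apply: (@exw_add w inp n.*2.+2); [rewrite /upd /=; lia|lia|].
apply: exw_seq; apply: exw_const; [lia|].
apply: exw_seq; apply: exw_const; [lia|].
apply: (@exw_store w inp n.*2.+1 s.+1); [by []|by []|].
split=> //=; last by rewrite andbT /bfs_area; lia.
exists n, 0, 0, (bfs_start s), [:: s], [::]; split.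
  split=> //; rewrite /upd /= ?addn0 ?addn1 //.
  - exact: bfs_inv_start.
  - by move=> v lv; have := ltn_ord v; lia.
  - by case=> // _; rewrite addn0 eqxx.
by right; rewrite /bfs_weight /= addn0 leqnn.
Qed.

(** A round costs 20 for the step and 3 for test, decrement and jump; the extra 2 are loading the
    counter and the final test. *)
Lemma bfs_run_spec (s : 'I_n) base K k r m :
  consts r -> r 10 = K -> K < 2 ^ w -> bfs_state s base k r m ->
  exw bfs_run r m (fun t r' m' => [/\ bfs_state s base (k - K) r' m',
    outs t = [::], size t <= 23 * K + 2 & all (bfs_area base) (accs t)]).
Proof.
move=> [R0 R1 R2] R10 Kw st.
apply: exw_seq; apply: (@exw_add w inp K); [rewrite /upd /=; lia|lia|].
apply: (@exw_conseq _ _ _ _ _ (fun t r' m' => exists2 t0, t = rcons t0 nop &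
  [/\ consts r', r' 23 = K - K, bfs_state s base (k - K) r' m', outs t0 = [::] &
      size t0 <= 23 * K /\ all (bfs_area base) (accs t0)])); last first.
  move=> t r' m' [t0 -> [_ _ h1 h2 [h3 h4]]]; split=> //.
  - by rewrite !outsE h2.
  - by rewrite /= size_rcons; lia.
  - by rewrite !accsE.
apply: (@exw_while _ _ 23 2 _ K (fun j t r m =>
  [/\ consts r, r 23 = K - j, bfs_state s base (k - j) r m, outs t = [::] &
      size t <= 23 * j /\ all (bfs_area base) (accs t)])).
- split=> //; first by rewrite /upd /= subn0.
  by rewrite subn0; apply: bfs_state_ext st _ _ => // a; rewrite /upd; case: eqP => //; lia.
- move=> {R10 R0 R1 R2 st} j t {}r {}m lt [[R0 R1 R2] R23 st ot [sz ac]].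
  split; first lia.
  apply: exw_seq; apply: exw_conseq (exw_frame (bfs_step_spec _ st)) _ => //.
  move=> t1 r1 m1 [[st1 ot1 sz1 ac1] fr _].
  apply: (@exw_sub w inp (K - j.+1)); rewrite ?fr //; try lia.
  split.
  + by split; rewrite /upd /= fr.
  + by rewrite /upd /=.
  + rewrite subnS; apply: bfs_state_ext st1 _ _ => // a; rewrite /upd; case: eqP => //; lia.
  + by rewrite !outsE ot ot1.
  + rewrite size_cat /= size_rcons size_cat /=; split; first lia.
    by rewrite !accsE !all_cat ac ac1.
- by move=> t r1 m1 [[_ _ ->] -> _ _ _]; rewrite subnn.
Qed.

(** * Partners, found without a search *)

(* The vertex whose pair with [u] is output in the first phase: a proper out- *)
(* neighbour if there is one, and otherwise any vertex other than [u].        *)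
Definition first (u : 'I_n) : 'I_n :=
  if [seq v <- adj u | v != u] is v :: _ then v else insubd u (val u == 0 : nat).

Lemma first_neq u : first u != u.
Proof.
rewrite /first; case e: [seq v <- adj u | v != u] => [|v l].
  (* The boolean read as a number is index 1 for the vertex of index 0 and index 0 for all others;
     both are valid as n > 1. *)
  rewrite -val_eqE /= val_insubd ifT; last by case: (_ == 0); rewrite // ltnW.
  by rewrite /=; case: (nat_of_ord u).
by have := mem_head v l; rewrite -e mem_filter => /andP[].
Qed.

(** A vertex without proper out-neighbours has only self-loops, so its walks never leave it. *)
Lemma dist_first u :
  dist E u (first u) = if [seq v <- adj u | v != u] is _ :: _ then Some 1 else None.
Proof.
have := first_neq u; rewrite /first; case e: [seq v <- adj u | v != u] => [|v l] ne.
  apply: dist_none; apply/negP=> /connect_has_walk[k] wk.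
  have : forall x, has_walk E u x k -> x = u.
    elim: (k) => [|j IH] x; first exact: has_walk0E.
    case/has_walkSE=> y /IH ->; rewrite -[E u x]/(x \in E u) -adj_mem => xu.
    apply/eqP/negP=> /negP nx; have : x \in [seq v <- adj u | v != u] by rewrite mem_filter nx.
    by rewrite e.
  by move/(_ _ wk)/eqP; rewrite (negbTE ne).
have : v \in [seq v <- adj u | v != u] by rewrite e mem_head.
rewrite mem_filter adj_mem => /andP[_ Ev]; apply: dist_some.
  by apply: has_walkS (has_walk0 _ _) Ev.
by case=> // /has_walk0E ev; rewrite ev eqxx in ne.
Qed.

(** Lists have no repetitions, so [u] occurs at most once in its own list and two cells suffice to
    find a proper neighbour in constant time. *)
Lemma first_neighbour_spec (u : 'I_n) r m : consts r -> r 3 = u.+1 ->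
  exw first_neighbour r m (fun t r' m' =>
    [/\ m' = m, r' 4 = (first u).+1,
        r' 5 = ([seq v <- adj u | v != u] != [::]), outs t = [::] &
        size t <= 20 /\ accs t = [::]]).
Proof.
move=> [R0 R1 R2] R3; have un := ltn_ord u; have wl := word_lin.
apply: exw_seq; apply: (@exw_add w inp u.+1); [lia|lia|].
apply: exw_seq; apply: (@exw_add w inp (n + u.+1)); [rewrite /upd /=; lia|lia|].
apply: exw_seq; apply: (@exw_read w inp (n + u.+1)); first by [].
apply: exw_seq.
set p := inp _.
have H r1 : consts r1 -> r1 3 = u.+1 -> r1 4 = u.+1 -> r1 6 = p ->
  exw scan_list r1 m (fun t r' m' => [/\ m' = m, consts r', r' 3 = u.+1,
         outs t = [::] & [/\ accs t = [::], size t <= 10 &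
         r' 4 = if [seq v <- adj u | v != u] is v :: _ then v.+1 else u.+1]]).
  move=> [S0 S1 S2] S3 S4 S6.
  have := adj_list u; have := adj_uniq u; rewrite -/p; case: (adj u) => [|v l] uq /=.
    move=> p0; apply: exw_if => [e6|]; last by lia.
    by apply: exw_skip.
  case=> p_gt0 pw pv lst.
  apply: exw_if => [|_]; first by lia.
  apply: exw_seq; apply: (@exw_read w inp p); first by [].
  rewrite pv; apply: exw_if; rewrite /upd /= S3 => e.
    have {}e : v = u by apply: val_inj; case: e.
    subst v; rewrite eqxx /=.
    apply: exw_seq; apply: (@exw_add w inp p.+1); [rewrite /upd /=; lia|lia|].
    apply: exw_seq; apply: (@exw_read w inp p.+1); first by [].
    case: l uq lst => [|x l] uq /= lst.
      apply: exw_if; rewrite /upd /=; last lia.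
      by move=> _; apply: exw_skip.
    case: lst => q_gt0 qw qx _.
    apply: exw_if; rewrite /upd /=; first by lia.
    move=> _; apply: (@exw_read w inp (inp p.+1)); first by [].
    have -> /= : x != u by apply: contraTneq uq => ->; rewrite /= inE eqxx.
    by split=> //; split=> //; rewrite /upd /= qx.
  have -> /= : v != u by apply/eqP => ev; case: e; rewrite ev.
  by apply: exw_skip.
apply: exw_conseq (H _ _ _ _ _) _ => //; try by rewrite /upd /=.
move=> t r1 m1 [-> [S0 S1 S2] S3 ot [at1 sz S4]].
pose ne := [seq v <- adj u | v != u] != [::].
apply: (@exw_conseq _ _ _ _ _ (fun t r' m' => [/\ m' = m, r' 4 = (first u).+1,
  r' 5 = ne, outs t = [::] & accs t = [::] /\ size t <= 5])); last first.
  move=> t2 r2 m2 [-> F4 F5 ot2 [at2 sz2]]; split=> //.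
    by rewrite !outsE ot ot2.
  split; last by rewrite !accsE at1 at2.
  by rewrite /= size_cat; lia.
rewrite /ne /first; case e: [seq v <- adj u | v != u] S4 => [|v l] S4 /=; last first.
  have vu : v != u.
    by have := mem_head v l; rewrite -e mem_filter => /andP[].
  apply: exw_if; rewrite S3 S4 => ev; first by case: ev => /val_inj ev; rewrite ev eqxx in vu.
  by apply: exw_const; [lia|].
apply: exw_if; rewrite S3 S4 // => _.
apply: exw_seq; apply: exw_const; [lia|].
apply: exw_if; rewrite /upd /= S1 S3 val_insubd => e1.
  by apply: exw_const; [lia|]; rewrite /upd /=; case: e1 => ->; rewrite n_gt1.
apply: exw_const; [lia|]; rewrite /upd /=; split=> //.
by case: eqP => [e0|_] /=; [rewrite e0 in e1|rewrite (ltn_trans _ n_gt1)].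
Qed.

Definition pair_out (u v : 'I_n) : triple := (u.+1, v.+1, dist E u v).

Lemma emit_first_spec (u : 'I_n) r m : consts r -> r 3 = u.+1 ->
  exw emit_first r m (fun t r' m' =>
    [/\ m' = m, outs t = [:: pair_out u (first u)], size t <= 25 & accs t = [::]]).
Proof.
move=> C R3; apply: exw_seq.
apply: exw_conseq (exw_frame (first_neighbour_spec m C R3)) _.
move=> t r1 m1 [[-> F4 F5 ot [sz at1]] fr _]; case: C => R0 R1 R2.
have de : dist E u (first u) = if r1 5 == 1 then Some 1 else None.
  by rewrite dist_first F5; case: filter.
have f3 : r1 3 = u.+1 by rewrite fr.
have f1 : r1 1 = 1 by rewrite fr.
apply: exw_if; rewrite f1 => e5; apply: exw_ins => //=.
  rewrite !outsE !accsE /= ot at1 size_cat /=; split=> //; last lia.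
  by rewrite /pair_out de e5 f3 F4 f1.
rewrite !outsE !accsE /= ot at1 size_cat /=; split=> //; last lia.
by rewrite f3 F4 /pair_out de ifN //; apply/eqP.
Qed.

(** * Degree sum and budget *)

Definition mid : nat := n.+1 %/ 2.
(* For odd [n] the degree of the middle vertex is counted twice in [degree_sum mid]. *)
Definition degree_sum (j : nat) : nat := \sum_(0 <= i < j) (inp i.+1 + inp (n - i)).
Definition edge_count : nat := \sum_(u < n) size (adj u).

Lemma degree_leq i : i < n -> inp i.+1 <= n.
Proof.
move=> lt; rewrite (degree_size (Ordinal lt)).
by rewrite -(card_uniqP (adj_uniq _)) -[leqRHS]card_ord max_card.
Qed.

Lemma degree_sum_leq j : j <= n -> degree_sum j <= n.*2 * j.
Proof.
move=> lej; apply: (@leq_trans (\sum_(0 <= i < j) n.*2)); last first.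
  by rewrite sum_nat_const_nat subn0 mulnC.
rewrite /degree_sum !big_nat; apply: leq_sum => i /andP[_ lt].
have h1 := @degree_leq i; have h2 := @degree_leq (n - i.+1).
have e : (n - i.+1).+1 = n - i by lia.
by rewrite e in h2; have := h1 ltac:(lia); have := h2 ltac:(lia); lia.
Qed.

Lemma edge_countE : edge_count = \sum_(0 <= i < n) inp i.+1.
Proof. by rewrite big_mkord; apply: eq_bigr => u _; rewrite degree_size. Qed.

Lemma degree_sum_rev j : j <= n ->
  degree_sum j = \sum_(0 <= i < j) inp i.+1 + \sum_(n - j <= i < n) inp i.+1.
Proof.
move=> lej; rewrite /degree_sum big_split /=; congr (_ + _).
rewrite -[n - j in RHS]add0n big_addn subKn // [RHS]big_nat_rev /= !big_nat.
by apply: eq_bigr => i /andP[_ lt]; congr inp; lia.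
Qed.

(** The first [mid] and the last [mid] vertices together cover all vertices, each at most twice. *)
Lemma degree_sum_mid : edge_count <= degree_sum mid <= edge_count.*2.
Proof.
have hn : mid <= n by rewrite /mid; lia.
rewrite degree_sum_rev // edge_countE.
have cut a b c : a <= b -> b <= c -> \sum_(a <= i < c) inp i.+1 =
    \sum_(a <= i < b) inp i.+1 + \sum_(b <= i < c) inp i.+1.
  by move=> ab bc; rewrite (big_cat_nat ab bc).
have hm : n - mid <= mid by rewrite /mid; lia.
have e1 := cut _ _ _ (leq0n mid) hn.
have e2 := cut _ _ _ (leq0n (n - mid)) (leq_subr mid n).
have e3 := cut _ _ _ hm hn.
lia.
Qed.

(* After the degrees are summed there remain at least [n / 3] slots of the    *)
(* first phase, during which a search, of at most [2 * n + edge_count] steps, *)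
(* has to finish.                                                             *)
Definition budget : nat := 3 * (degree_sum mid %/ n) + 9.

Lemma budget_work : bfs_work <= (n - mid) * budget.
Proof.
have -> : bfs_work = n.*2 + edge_count.
  rewrite /bfs_work /edge_count; under eq_bigr do rewrite -add1n.
  by rewrite big_split /= sum1_card card_ord; lia.
have /andP[h1 _] := degree_sum_mid.
have h2 := divn_eq (degree_sum mid) n.
have h3 : degree_sum mid %% n < n by rewrite ltn_mod; lia.
rewrite /budget; set q := degree_sum mid %/ n in h2 *.
(* The worst case is n = 3. With q the quotient, n (q + 3) exceeds the degree sum plus 2n, one n
   absorbing the rounding; the factor 3 then gives K = 3q + 9. *)
have h4 : n <= 3 * (n - mid) by rewrite /mid; lia.
apply: (@leq_trans (n * (q + 3))); first lia.
have -> : (n - mid) * (3 * q + 9) = 3 * (n - mid) * (q + 3) by lia.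
by rewrite leq_mul2r h4 orbT.
Qed.

Lemma budget_leq : n * budget <= 6 * edge_count + 9 * n.
Proof.
have /andP[_ h1] := degree_sum_mid.
have h2 := divn_eq (degree_sum mid) n; rewrite /budget; lia.
Qed.

Lemma budget_word : budget <= 6 * n + 9.
Proof.
rewrite /budget leq_add2r (_ : 6 * n = 3 * (n.*2)); last lia.
rewrite leq_mul2l /= -[leqRHS](@mulnK _ n); last lia.
have hn : mid <= n by rewrite /mid; lia.
apply: leq_div2r; apply: leq_trans (degree_sum_leq hn) _.
by rewrite leq_mul2l hn orbT.
Qed.

(** * The phase of the partner outputs *)

Definition first_outs (s : seq 'I_n) : seq triple := [seq pair_out u (first u) | u <- s].

Lemma degree_phase_spec B r m : consts r -> 100 <= B ->
  exw degree_phase r m (fun t r' m' =>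
    [/\ m' = m, consts r', r' 3 = mid.+1 /\ r' 8 = degree_sum mid,
        outs t = first_outs (take mid (enum 'I_n)) &
        accs t = [::] /\ paced B 10 t 40]).
Proof.
move=> [R0 R1 R2] leB; have wl := word_lin.
have hn : mid < n by rewrite /mid; lia.
apply: exw_seq; apply: (@exw_add w inp 1); [rewrite /upd /=; lia|lia|].
apply: exw_seq; apply: (@exw_add w inp n); [rewrite /upd /=; lia|lia|].
apply: exw_seq; apply: exw_const; [lia|].
apply: exw_seq; apply: (@exw_add w inp n.+1); [rewrite /upd /=; lia|lia|].
apply: exw_seq; apply: (@exw_shr w inp mid); [by rewrite /upd /= R1 expn1|lia|].
apply: exw_seq; apply: (@exw_add w inp mid.+1); [rewrite /upd /=; lia|lia|].
set r1 := upd _ _ _; rewrite /=.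
have H : exw (While 3 9 (block
        [:: emit_first; Ins (ReadInp 28 3); Plus 8 8 28; Ins (ReadInp 28 7);
            Plus 8 8 28; Plus 3 3 1; Minus 7 7 1])) r1 m
   (fun t r' m' => exists2 t0, t = rcons t0 nop & [/\ m' = m, consts r',
     [/\ r' 3 = mid.+1, r' 7 = n - mid, r' 9 = mid.+1 & r' 8 = degree_sum mid],
        outs t0 = first_outs (take mid (enum 'I_n)) &
        accs t0 = [::] /\ paced B 20 t0 35]).
  apply: (@exw_while _ _ _ _ _ mid (fun j t r' m' => [/\ m' = m, consts r',
     [/\ r' 3 = j.+1, r' 7 = n - j, r' 9 = mid.+1 & r' 8 = degree_sum j],
        outs t = first_outs (take j (enum 'I_n)) &
        accs t = [::] /\ paced B 20 t 35])).
  - split=> //; last by split=> //; apply: paced_size => /=; lia.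
      by split; rewrite /r1 /upd /= ?subn0 // /degree_sum big_geq.
    by rewrite take0.
  - move=> j t r2 m2 lt [-> C2 [S3 S7 S9 S8] ot [at1 pt]]; split; first lia.
    have ltn : j < n by lia.
    have dl := degree_sum_leq (ltnW ltn); have dl1 := degree_sum_leq ltn.
    have dS : degree_sum j.+1 = degree_sum j + inp j.+1 + inp (n - j).
      by rewrite /degree_sum big_nat_recr //= addnA.
    (* Partial degree sums can be of order n^2; this is where a linear bound on the word range would
       not do. *)
    have nn : n.*2 * j.+1 < 2 ^ w.
      apply: leq_trans word_big; rewrite expnS expn1.
      apply: (@leq_trans (n.+1.*2 * n.+1)); last lia.
      by rewrite ltn_mul //; lia.
    have /= H1 := @emit_first_spec (Ordinal ltn) r2 m C2 S3.
    apply: exw_seq; apply: exw_conseq (exw_frame H1) _.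
    move=> t1 r3 m3 [[-> ot1 sz1 at2] fr _]; case: C2 => S0 S1 S2.
    apply: exw_seq; apply: (@exw_read w inp j.+1); first by rewrite fr.
    apply: exw_seq; apply: (@exw_add w inp (degree_sum j + inp j.+1)); [by rewrite /upd /= fr // S8|lia|].
    apply: exw_seq; apply: (@exw_read w inp (n - j)); first by rewrite /upd /= fr.
    apply: exw_seq; apply: (@exw_add w inp (degree_sum j.+1)); [by rewrite /upd /= dS|lia|].
    apply: exw_seq; apply: (@exw_add w inp j.+2); [rewrite /upd /= !fr // S3 S1; lia|lia|].
    apply: (@exw_sub w inp (n - j.+1)); [rewrite /upd /= !fr // S7 S1; lia|rewrite /upd /= !fr // S7; lia|].
    split=> //.
    + by split; rewrite /upd /= fr.
    + by split; rewrite /upd /= ?fr.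
    + by rewrite !outsE ot ot1 /= (take_enum ltn) /first_outs map_rcons -cats1.
    + rewrite !accsE at1 at2; split=> //; apply: paced_cat pt _; apply: paced_out => //.
      * by rewrite !outsE ot1.
      * by rewrite /= size_rcons size_cat /=; lia.
      * by rewrite /= size_rcons size_cat /=; lia.
  - by move=> t r' m' [_ _ [-> _ -> _] _ _].
apply: exw_conseq H _ => t r' m' [t0 -> [-> C' [S3 S7 S9 S8] ot [at1 pt]]]; split=> //.
  by rewrite !outsE ot.
split; first by rewrite !accsE at1.
apply: (@paced_cat _ _ [:: nop; nop; nop; nop; nop; nop] 20).
  by apply: paced_size => //=; lia.
by rewrite -cats1; apply: paced_cat pt _; apply: paced_size => /=; lia.
Qed.

Definition env r := [/\ consts r, r 10 = budget, r 19 = n.*2.+1 & r 24 = n.+1].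

Lemma env_ext r r' : env r -> all (fun a => r' a == r a) [:: 0; 1; 2; 10; 19; 24] -> env r'.
Proof.
case=> -[h0 h1 h2] h3 h4 h5 /= /and5P[/eqP e0 /eqP e1 /eqP e2 /eqP e3].
by case/and3P=> /eqP e4 /eqP e5 _; split; [split|..]; rewrite ?e0 ?e1 ?e2 ?e3 ?e4 ?e5.
Qed.

Lemma budget_lt : budget < 2 ^ w.
Proof.
have := budget_word; have := word_lin; lia.
Qed.

Definition slot_time : nat := 30 * budget.

(** As K >= 9, the surplus 7 K of [slot_time] absorbs the constant overhead of up to 60 steps around
    a run of the search. *)
Lemma slot_time_ge : 9 <= budget /\ 23 * budget + 60 <= slot_time.
Proof.
have : 9 <= budget by rewrite /budget leq_addl.
by split=> //; rewrite /slot_time; lia.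
Qed.

Lemma set_budget_spec r m : consts r -> r 8 = degree_sum mid ->
  exw set_budget r m (fun t r' m' => [/\ m' = m, env r', [/\ r' 12 = 1, r' 18 = 0 & r' 3 = r 3],
    outs t = [::] & accs t = [::] /\ size t <= 10]).
Proof.
move=> [R0 R1 R2] R8; have wl := word_lin; have bl := budget_lt.
have qn : degree_sum mid %/ n < 2 ^ w by apply: leq_ltn_trans bl; rewrite /budget; move: (_ %/ _) => q; lia.
have bE : budget = 3 * (degree_sum mid %/ n) + 9 by [].
apply: exw_seq; apply: (@exw_div w inp (degree_sum mid %/ n)); [by rewrite R8 R0|lia|].
apply: exw_seq; apply: exw_const; [lia|].
apply: exw_seq; apply: (@exw_mul w inp (3 * (degree_sum mid %/ n))); [by rewrite /upd /= mulnC|lia|].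
apply: exw_seq; apply: exw_const; [lia|].
apply: exw_seq; apply: (@exw_add w inp budget); [by rewrite /upd /=|lia|].
apply: exw_seq; apply: (@exw_add w inp 1); [rewrite /upd /=; lia|lia|].
apply: exw_seq; apply: exw_const; [lia|].
apply: exw_seq; apply: (@exw_add w inp n.*2); [rewrite /upd /=; lia|lia|].
apply: exw_seq; apply: (@exw_add w inp n.*2.+1); [rewrite /upd /=; lia|lia|].
apply: (@exw_add w inp n.+1); [rewrite /upd /=; lia|lia|].
by split.
Qed.

Lemma area_leq base s : base <= n -> all (bfs_area base) s -> all (fun x => x <= 3 * n) s.
Proof. by move=> lb; apply: sub_all => x; rewrite /bfs_area; lia. Qed.

Lemma first_phase_spec (z : 'I_n) B r m : env r -> r 3 = mid.+1 -> val z = 0 ->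
  r 12 = 1 -> r 18 = 0 -> 4 * slot_time <= B ->
  exw first_phase r m (fun t r' m' => [/\ env r', bfs_state z 0 0 r' m',
    outs t = first_outs (drop mid (enum 'I_n)), all (fun x => x <= 3 * n) (accs t) &
    paced B 100 t (2 * slot_time)]).
Proof.
move=> Ev R3 z0 R12 R18 leB; have wl := word_lin; have [b9 st] := slot_time_ge.
have hn : mid <= n by rewrite /mid; lia.
have [C R10 R19 R24] := Ev.
apply: exw_seq; apply: exw_conseq (exw_frame (bfs_begin_spec (s := z) m C _ R18 _ R19)) _ => //.
  by rewrite R12 -z0.
move=> t1 r1 m1 [[st1 ot1 sz1 ac1] fr1 _].
apply: (@exw_conseq _ _ _ _ _ (fun t r' m' => exists2 t0, t = rcons t0 nop &
  [/\ env r' /\ r' 3 = (mid + (n - mid)).+1, bfs_state z 0 (bfs_work - (n - mid) * budget) r' m',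
    first_outs (take mid (enum 'I_n)) ++ outs t0 = first_outs (take (mid + (n - mid)) (enum 'I_n)),
    all (bfs_area 0) (accs t0) & paced B 110 t0 slot_time])); last first.
  move=> t r' m' [t0 -> [[Ev' _] st' ot' ac' pt]]; split=> //.
  (* The truncated difference vanishes, so the search from vertex 1 is complete when the partner
     outputs end. *)
  - have := budget_work; rewrite -subn_eq0 => /eqP e.
    by rewrite e in st'.
  - have e : take n (enum 'I_n) = enum 'I_n by rewrite take_oversize ?size_enum_ord.
    move: ot'; rewrite subnKC // e.
    rewrite -{2}(cat_take_drop mid (enum 'I_n)) /first_outs map_cat => /eqP.
    by rewrite eqseq_cat // eqxx /= => /eqP <-; rewrite !outsE ot1 /=.
  - by rewrite !accsE all_cat !(@area_leq 0).
  - apply: (@paced_cat _ _ _ 110); first by apply: paced_size; lia.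
    rewrite -cats1; apply: paced_cat pt _; apply: paced_size => /=; lia.
apply: (@exw_while _ _ 3 24 _ (n - mid) (fun j t0 r' m' => 
  [/\ env r' /\ r' 3 = (mid + j).+1, bfs_state z 0 (bfs_work - j * budget) r' m',
    first_outs (take mid (enum 'I_n)) ++ outs t0 = first_outs (take (mid + j) (enum 'I_n)),
    all (bfs_area 0) (accs t0) & paced B 110 t0 slot_time])).
- split=> //.
  + split; last by rewrite fr1 // addn0.
    by apply: env_ext Ev _; rewrite /= !fr1 // !eqxx.
  + by rewrite mul0n subn0.
  + by rewrite addn0 cats0.
  + by apply: paced_size => /=; lia.
- move=> j t r2 m2 lt [[Ev2 S3] st2 ot2 ac2 pt2].
  have [C2 S10 S19 S24] := Ev2.
  split; first by rewrite S3 S24; lia.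
  have ltn : mid + j < n by lia.
  have /= H1 := @emit_first_spec (Ordinal ltn) r2 m2 C2 S3.
  apply: exw_seq; apply: exw_conseq (exw_frame H1) _.
  move=> t3 r3 m3 [[-> ot3 sz3 ac3] fr3 _]; have [S0 S1 S2] := C2.
  apply: exw_seq; apply: (@exw_add w inp (mid + j).+2); [by rewrite !fr3 // S3 S1 addn1|lia|].
  have st3 : bfs_state z 0 (bfs_work - j * budget) (upd r3 3 (mid + j).+2) m2.
    apply: bfs_state_ext st2 _ _ => // a ha; rewrite /upd ifN; last by apply/eqP; lia.
    by apply: fr3; move: ha; do 20 (case: a => [|a] //).
  have C3 : consts (upd r3 3 (mid + j).+2) by split; rewrite /upd /= fr3.
  apply: exw_conseq (exw_frame (bfs_run_spec C3 _ budget_lt st3)) _.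
    by rewrite /upd /= fr3.
  move=> t4 r4 m4 [[st4 ot4 sz4 ac4] fr4 _].
  split.
  + split; last by rewrite fr4 // addnS.
    by apply: env_ext Ev2 _; rewrite /= !fr4 // /upd /= !fr3 // !eqxx.
  + by rewrite mulSn addnC subnDA.
  + rewrite !outsE catA ot2 ot3 ot4 addnS (take_enum ltn) cats0.
    by rewrite /first_outs map_rcons cats1.
  + by rewrite !accsE !all_cat ac2 ac3 ac4.
  + apply: paced_cat pt2 _; apply: paced_out.
    * by rewrite !outsE ot3.
    * by rewrite /= size_rcons !size_cat /=; lia.
    * by rewrite /= size_rcons !size_cat /=; lia.
- by move=> t r2 m2 [[[_ _ _ ->] ->] _ _ _ _]; rewrite subnKC.
Qed.

(** * The phases of the sources *)

Definition skips (u v : 'I_n) : bool := (v == u) || (v == first u).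

Definition source_outs (u : 'I_n) (s : seq 'I_n) : seq triple :=
  [seq pair_out u v | v <- s & ~~ skips u v].

Lemma slot_spec (u v s : 'I_n) b base k r m : env r ->
  r 3 = u.+1 -> r 4 = (first u).+1 -> r 25 = b -> b <= n -> r 26 = v.+1 ->
  m (b + v.+1) = odflt n (dist E u v) -> dist E u v != Some n ->
  bfs_state s base k r m ->
  exw slot r m (fun t r' m' => [/\ r' 26 = v.+2, bfs_state s base (k - budget) r' m',
    outs t = source_outs u [:: v], size t <= 23 * budget + 15 &
    exists2 a, accs t = b + v.+1 :: a & all (bfs_area base) a /\
      forall x, ~~ bfs_area base x -> m' x = m x]).
Proof.
move=> Ev R3 R4 R25 lb R26 mv dn st; have wl := word_lin.
have [[R0 R1 R2] R10 R19 R24] := Ev; have vn := ltn_ord v.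
apply: exw_seq; apply: (@exw_add w inp (b + v.+1)); [lia|lia|].
apply: exw_seq; apply: (@exw_load w inp (b + v.+1)); [by []|].
rewrite mv; set r1 := upd _ _ _.
apply: exw_seq.
apply: (@exw_conseq _ _ _ _ _ (fun t r' m' => [/\ r' = r1, m' = m,
   outs t = source_outs u [:: v], size t <= 10 & accs t = [::]])).
  have fv (x : 'I_n) : v.+1 = x.+1 -> v = x by case=> /val_inj.
  rewrite /source_outs /= /skips; apply: exw_if; rewrite /r1 /upd /= R26 ?R3 => e3.
    by apply: exw_skip; rewrite (fv _ e3) eqxx.
  have /negbTE -> /= : v != u by apply: contra_not_neq e3 => ->.
  apply: exw_if; rewrite /upd /= R26 R4 => e4.
    by apply: exw_skip; rewrite (fv _ e4) eqxx.
  have /negbTE -> /= : v != first u by apply: contra_not_neq e4 => ->.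
  apply: exw_if; rewrite /upd /= R0 => e27; apply: exw_ins => //; split=> //=.
    rewrite R3 R26 /pair_out; case: (dist E u v) dn e27 => //= x ne xn.
    by rewrite xn eqxx in ne.
  rewrite R3 R26 /pair_out; case: (dist E u v) dn e27 => //= x ne xn.
move=> t2 r2 m2 [-> -> ot2 sz2 ac2].
apply: exw_seq; apply: (@exw_add w inp v.+2); [rewrite /r1 /upd /=; lia|lia|].
have st1 : bfs_state s base k (upd r1 26 v.+2) m.
  apply: bfs_state_ext st _ _ => // a ha; rewrite /r1 /upd !ifN //; by apply/eqP; lia.
have C1 : consts (upd r1 26 v.+2) by [].
apply: exw_conseq (exw_frame (bfs_run_spec C1 _ budget_lt st1)) _.
  by [].
move=> t4 r4 m4 [[st4 ot4 sz4 ac4] fr4 fm4].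
split=> //.
- by rewrite fr4.
- by rewrite !outsE ot2 ot4 /= cats0.
- rewrite !size_cat /=; lia.
- exists (accs t4); first by rewrite !accsE ac2.
  split=> // x nx; apply: fm4; apply: contra nx; exact: (allP ac4).
Qed.

Lemma count_skips u s : uniq s -> count (skips u) s <= 2.
Proof.
move=> us; have := count_predUI (pred1 u) (pred1 (first u)) s.
rewrite !(count_uniq_mem _ us) => h.
apply: (@leq_trans (count (predU (pred1 u) (pred1 (first u))) s)).
  by apply: eq_leq; apply: eq_count.
by clear -h; lia.
Qed.

(* Idle time after [j] slots of a source entered with idle time [c]: if not   *)
(* all of these slots were silent, an output was followed by at most the [e   *)
(* <= 2] silent ones.                                                         *)
Definition slot_bound u c j :=
  let e := count (skips u) (take j (enum 'I_n)) in
  slot_time * e.+1 + (if j == e then c else 0).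

(** For n > 2 some slot produces an output and the incoming idle time [c] is forgotten. For n = 2
    both targets are skipped, the phase is silent and [c] is carried over. The accesses to
    [b + i.+1] serve the lower bound on space. *)
Lemma source_phase_spec (u : 'I_n) b c B r m : env r -> r 3 = u.+1 -> r 12 = u.+1 ->
  r 18 = b -> b = 0 \/ b = n -> bfs_state u b 0 r m -> c + 5 * slot_time <= B ->
  exw source_phase r m (fun t r' m' => [/\ env r' /\ r' 3 = u.+2,
    exists2 s : 'I_n, r' 12 = s.+1 /\ (u.+1 < n -> val s = u.+1) &
      r' 18 = n - b /\ bfs_state s (n - b) 0 r' m',
    outs t = source_outs u (enum 'I_n),
    all (fun x => x <= 3 * n) (accs t) /\ (forall i, i < n -> b + i.+1 \in accs t) &
    paced B c t (4 * slot_time + (if n == 2 then c else 0))]).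
Proof.
move=> Ev R3 R12 R18 b0n st leB; have wl := word_lin; have [b9 sl] := slot_time_ge.
have [C R10 R19 R24] := Ev; have [R0 R1 R2] := C; have un := ltn_ord u.
have lb : b <= n by case: b0n; lia.
have dm := bfs_state_done st.
apply: exw_seq; apply: exw_conseq (exw_frame (first_neighbour_spec m C R3)) _.
move=> t1 r1 m1 [[-> F4 _ ot1 [sz1 ac1]] fr1 _].
apply: exw_seq; apply: (@exw_add w inp b); [by rewrite !fr1 // R18 R2 addn0|lia|].
apply: exw_seq; apply: (@exw_sub w inp (n - b)); [rewrite /upd /= !fr1 // R18 R0; lia|rewrite /upd /= fr1 // R0; lia|].
set r2 := upd _ _ _; apply: exw_seq.
apply: (@exw_conseq _ _ _ _ _ (fun t r' m' => [/\ m' = m, 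
  exists2 s : 'I_n, r' 12 = s.+1 & u.+1 < n -> val s = u.+1,
  forall a, a != 12 -> r' a = r2 a, outs t = [::] & size t <= 3 /\ accs t = [::]])).
  apply: exw_if; rewrite {1 2}/r2 /upd /= !fr1 // R12 R0 => e.
    by apply: exw_skip; split=> //; exists u; rewrite /r2 /upd /= ?fr1 // e ltnn.
  have lt : u.+1 < n by rewrite ltn_neqAle un andbT; apply/eqP.
  apply: (@exw_add w inp u.+2); [rewrite /r2 /upd /= !fr1 //; lia|lia|].
  split=> //; first by exists (Ordinal lt).
  by move=> a /negbTE ne; rewrite /upd ne.
move=> t2 r3 m3 [-> [s R12' sE] fr3 ot2 [sz2 ac2]].
have C3 : consts r3 by split; rewrite fr3 // /r2 /upd /= fr1.
apply: exw_seq.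
have R18' : r3 18 = n - b by rewrite fr3 // /r2 /upd.
have R19' : r3 19 = n.*2.+1 by rewrite fr3 // /r2 /upd /= fr1.
apply: exw_conseq (exw_frame (bfs_begin_spec m C3 R12' R18' (leq_subr b n) R19')) _.
move=> t3 r4 m4 [[st4 ot3 sz3 ac3] fr4 fm4].
apply: exw_seq; apply: (@exw_add w inp 1); [rewrite !fr4 // !fr3 // /r2 /upd /= !fr1 // R1 R2; lia|lia|].
set r5 := upd r4 26 1.
have r5E a : a \notin [:: 26; 12; 18; 25] ++ writes bfs_begin ++ writes first_neighbour -> r5 a = r a.
  rewrite mem_cat negb_or => /andP[na]; rewrite mem_cat negb_or => /andP[nb nf].
  move: na; rewrite !inE !negb_or => /and4P[n26 n12 n18 n25].
  rewrite /r5 /upd (negbTE n26) fr4 // fr3 // /r2 /upd (negbTE n18) (negbTE n25) fr1 //.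
have st5 : bfs_state s (n - b) bfs_work r5 m4.
  by apply: bfs_state_ext st4 _ _ => // a ha; rewrite /r5 /upd ifN //; apply/eqP; lia.
(* The table being read at [b] and the words of the running search, based at [n - b], are
   disjoint. *)
have disj (v : 'I_n) : ~~ bfs_area (n - b) (b + v.+1).
  by have := ltn_ord v; rewrite /bfs_area; case: b0n => ->; lia.
have Ev5 : env r5 by apply: env_ext Ev _; rewrite /= !r5E // !eqxx.
apply: exw_seq.
apply: (@exw_conseq _ _ _ _ _ (fun t r' m' => exists2 t0, t = rcons t0 nop &
  [/\ env r' /\ [/\ r' 3 = u.+1, r' 4 = (first u).+1, r' 12 = s.+1, r' 18 = n - b &
      r' 25 = b] /\ r' 26 = n.+1, 
      bfs_state s (n - b) (bfs_work - n * budget) r' m' /\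
      (forall v : 'I_n, m' (b + v.+1) = odflt n (dist E u v)),
      outs t0 = source_outs u (take n (enum 'I_n)),
      all (fun x => x <= 3 * n) (accs t0) /\ (forall i, i < n -> b + i.+1 \in accs t0) &
      paced B (c + 40) t0 (slot_bound u c n)])).
  apply: (@exw_while _ _ 26 24 _ n (fun j t0 r' m' => 
  [/\ env r' /\ [/\ r' 3 = u.+1, r' 4 = (first u).+1, r' 12 = s.+1, r' 18 = n - b &
      r' 25 = b] /\ r' 26 = j.+1, 
      bfs_state s (n - b) (bfs_work - j * budget) r' m' /\
      (forall v : 'I_n, m' (b + v.+1) = odflt n (dist E u v)),
      outs t0 = source_outs u (take j (enum 'I_n)),
      all (fun x => x <= 3 * n) (accs t0) /\ (forall i, i < j -> b + i.+1 \in accs t0) &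
      paced B (c + 40) t0 (slot_bound u c j)])).
  - split=> //.
    + split=> //; split=> //; split.
      * by rewrite r5E.
      * by rewrite /r5 /upd /= fr4 // fr3 // /r2 /upd /=.
      * by rewrite /r5 /upd /= fr4.
      * by rewrite /r5 /upd /= fr4.
      * by rewrite /r5 /upd /= fr4 // fr3.
    + rewrite mul0n subn0; split=> // v; rewrite fm4; first by case: (dm v).
      by apply: contra (disj v); apply: (allP ac3).
    + by rewrite take0.
    + by apply: paced_size; rewrite /slot_bound take0 /= ?eqxx; lia.
  - move=> j t r6 m6 ltj [[Ev6 [[S3 S4 S12 S18 S25] S26]] [st6 dm6] ot6 [ac6 in6] pt6].
    split; first by have [_ _ _ ->] := Ev6; rewrite S26; lia.
    have := @slot_spec u (Ordinal ltj) s b (n - b) _ r6 m6 Ev6 S3 S4 S25 lb S26 (dm6 _) (dm _).2 st6.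
    move/exw_frame/exw_conseq; apply=> t7 r7 m7 [[S26' st7 ot7 sz7 [a at7 [aa am]]] fr7 _].
    split.
    + split; first by apply: env_ext Ev6 _; rewrite /= !fr7 // !eqxx.
      by split=> //; split; rewrite fr7.
    + by rewrite mulSn addnC subnDA; split=> // v; rewrite am.
    + by rewrite !outsE ot6 ot7 (take_enum ltj) /source_outs filter_rcons; case: ifP => h;
        rewrite /= h ?cats0 // map_rcons cats1.
    + rewrite !accsE at7; split.
        rewrite all_cat ac6 /= (@area_leq (n - b)) ?leq_subr // andbT; lia.
      move=> i; rewrite ltnS leq_eqVlt mem_cat inE => /orP[/eqP ->|lt]; first by rewrite eqxx orbT.
      by rewrite in6.
    + apply: paced_cat pt6 _.
      have us : uniq (take j.+1 (enum 'I_n)) by rewrite take_uniq ?enum_uniq.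
      have := count_skips u us; rewrite /slot_bound (take_enum ltj) -cats1 count_cat /= addn0.
      have := count_size (skips u) (take j (enum 'I_n)); rewrite size_take size_enum_ord ltj.
      set e := count _ _ => le1 le2.
      have sz : size (nop :: rcons t7 nop) <= slot_time by rewrite /= size_rcons; lia.
      rewrite /source_outs /= in ot7.
      (* A silent slot raises the count of skips together with the slot number; any other slot
         resets the idle time. *)
      case: (skips u (Ordinal ltj)) ot7 le2 => /= ot7 le2.
        rewrite addn1 eqSS; apply: paced_size; first by case: ifP; nia.
        by case: ifP; nia.
      rewrite addn0 in le2 *; rewrite (_ : (j.+1 == e) = false); last by apply/eqP; lia.
      apply: paced_out.
      * by rewrite !outsE ot7.
      * by case: ifP; nia.
      * by rewrite addn0; apply: leq_trans sz _; rewrite leq_pmulr.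
  - by move=> t r6 m6 [[[_ _ _ ->] [_ ->]] _ _ _ _].
move=> t6 r6 m6 [t0 -> [[Ev6 [[S3 S4 S12 S18 S25] S26]] [st6 dm6] ot6 [ac6 in6] pt6]].
have [[S0 S1 S2] _ _ _] := Ev6.
apply: (@exw_add w inp u.+2); [lia|lia|].
have szp : size ([:: nop] ++ [:: nop] ++ t2 ++ t3 ++ [:: nop]) <= 15.
  by rewrite /= !size_cat /=; lia.
split=> //.
- exists s; first by [].
  split=> //; apply: bfs_state_ext (_ : bfs_state s (n - b) 0 r6 m6) _ _ => //.
    have : bfs_work <= n * budget.
      by apply: leq_trans budget_work _; rewrite leq_mul2r leq_subr orbT.
    by rewrite -subn_eq0 => /eqP e; rewrite e in st6.
  by move=> a ha; rewrite /upd ifN //; apply/eqP; lia.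
- rewrite !outsE ot1 ot2 ot3 ot6 take_oversize ?size_enum_ord //=.
  by rewrite cats0.
- rewrite !accsE ac1 ac2 /=; split.
    by rewrite !all_cat ac6 andbT (@area_leq (n - b)) ?leq_subr.
  by move=> i lt; rewrite !mem_cat in6 ?orbT.
- rewrite (_ : t1 ++ _ = (t1 ++ [:: nop] ++ [:: nop] ++ t2 ++ t3 ++ [:: nop]) ++ rcons t0 nop ++ [:: nop]);
    last by rewrite -!catA.
  apply: (@paced_cat _ _ _ (c + 40)).
    by apply: paced_size; [rewrite size_cat; lia|lia].
  rewrite -cats1 -catA; apply: paced_cat pt6 _; rewrite /slot_bound.
  have us : uniq (take n (enum 'I_n)) by rewrite take_uniq ?enum_uniq.
  have := count_skips u us; set e := count _ _ => le2.
  apply: paced_size => /=.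
    case: (n =P 2) => [n2|nn2]; first by case: ifP; nia.
    by rewrite ifF; [nia|apply/eqP; lia].
  by case: ifP; nia.
Qed.
Definition all_outs : seq triple :=
  first_outs (enum 'I_n) ++ flatten [seq source_outs u (enum 'I_n) | u <- enum 'I_n].

Lemma main_phase_spec (z : 'I_n) B r m : env r -> r 3 = 1 -> val z = 0 ->
  r 12 = 1 -> r 18 = 0 -> bfs_state z 0 0 r m -> 20 * slot_time <= B ->
  exw (While 3 24 source_phase) r m (fun t r' m' => [/\ paced B (5 * slot_time) t (19 * slot_time),
    outs t = flatten [seq source_outs u (enum 'I_n) | u <- enum 'I_n],
    all (fun x => x <= 3 * n) (accs t) &
    exists b, forall i, i < n -> b + i.+1 \in accs t]).
Proof.
move=> Ev R3 z0 R12 R18 st leB; have [b9 sl] := slot_time_ge.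
(* Idle time accumulates only for n = 2, hence over two sources, and stays within 15 slots. *)
pose bound j := 5 * slot_time * (1 + (if n == 2 then j else 0)).
apply: (@exw_conseq _ _ _ _ _ (fun t r' m' => exists2 t0, t = rcons t0 nop &
  [/\ env r' /\ r' 3 = n.+1,
      exists s : 'I_n, exists2 b, b = 0 \/ b = n &
       [/\ r' 12 = s.+1, n < n -> val s = n, r' 18 = b & bfs_state s b 0 r' m'],
      outs t0 = flatten [seq source_outs u (enum 'I_n) | u <- take n (enum 'I_n)],
      all (fun x => x <= 3 * n) (accs t0) /\
      (0 < n -> exists b, forall i, i < n -> b + i.+1 \in accs t0) &
      paced B (5 * slot_time) t0 (bound n)])); last first.
  move=> t r' m' [t0 -> [_ _ ot [ac /(_ (ltnW n_gt1))[b in0]] pt]]; split.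
  - rewrite -cats1; apply: paced_cat pt _; apply: paced_size; last lia.
    by rewrite /bound /=; case: eqP => [->|_]; lia.
  - by rewrite !outsE ot take_oversize ?size_enum_ord.
  - by rewrite !accsE.
  - by exists b => i lt; rewrite !accsE; apply: in0.
apply: (@exw_while _ _ 3 24 _ n (fun j t0 r' m' =>
  [/\ env r' /\ r' 3 = j.+1,
      exists s : 'I_n, exists2 b, b = 0 \/ b = n &
       [/\ r' 12 = s.+1, j < n -> val s = j, r' 18 = b & bfs_state s b 0 r' m'],
      outs t0 = flatten [seq source_outs u (enum 'I_n) | u <- take j (enum 'I_n)],
      all (fun x => x <= 3 * n) (accs t0) /\
      (0 < j -> exists b, forall i, i < n -> b + i.+1 \in accs t0) &
      paced B (5 * slot_time) t0 (bound j)])).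
- split=> //.
  + exists z, 0; first by left.
    by split=> //; rewrite R12; congr S; exact: esym z0.
  + by rewrite take0.
  + by apply: paced_size; rewrite /bound /=; case: eqP; lia.
- move=> j t r1 m1 ltj [[Ev1 S3] [s [b b0n [S12 sj S18 st1]]] ot [ac in0] pt].
  split; first by have [_ _ _ ->] := Ev1; rewrite S3; lia.
  have es : s = Ordinal ltj by apply: val_inj; rewrite /= sj.
  subst s.
  have := @source_phase_spec (Ordinal ltj) b (bound j).+1 B r1 m1 Ev1 S3 S12 S18 b0n st1.
  have bj : bound j <= 10 * slot_time by rewrite /bound; case: eqP => [n2|_]; nia.
  move=> /(_ ltac:(lia)) /exw_conseq; apply=> t2 r2 m2.
  move=> [Ev2 [s [S12' sE] [S18' st2]] ot2 [ac2 in2] pt2].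
  split=> //.
  + exists s, (n - b); first by case: b0n => ->; lia.
    by split.
  + by rewrite !outsE ot ot2 (take_enum ltj) map_rcons flatten_rcons.
  + rewrite !accsE; split; first by rewrite all_cat ac ac2.
    by move=> _; exists b => i lt; rewrite mem_cat in2 ?orbT.
  + apply: paced_cat pt _; rewrite -cats1 -cat1s.
    apply: (@paced_cat _ _ _ (bound j).+1); first by apply: paced_size => /=; lia.
    apply: paced_cat pt2 _; apply: paced_size => /=.
      by rewrite /bound; case: eqP => [n2|_]; nia.
    by rewrite /bound; case: eqP => [n2|_]; nia.
- by move=> t r1 m1 [[[_ _ _ ->] ->] _ _ _ _].
Qed.

Lemma apsd_spec m : inp 0 = n ->
  exw apsd (fun=> 0) m (fun t r' m' => [/\ okgap (20 * slot_time) 0 t,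
    outs t = all_outs, all (fun x => x <= 3 * n) (accs t) &
    exists b, forall i, i < n -> b + i.+1 \in accs t]).
Proof.
move=> i0; have wl := word_lin; have [b9 sl] := slot_time_ge.
have n_gt0 : 0 < n := ltnW n_gt1.
set B := 20 * slot_time.
apply: exw_seq; apply: (@exw_read w inp 0); first by [].
apply: exw_seq; apply: exw_const; [lia|].
rewrite i0; set r1 := upd _ _ _.
have C1 : consts r1 by [].
apply: exw_if => [e|_]; first by move: e; rewrite /r1 /upd /=; lia.
apply: exw_seq; apply: exw_conseq (degree_phase_spec (B := B) m C1 _) _; first lia.
move=> t2 r2 m2 [-> C2 [S3 S8] ot2 [ac2 pt2]].
apply: exw_seq; apply: exw_conseq (set_budget_spec m C2 S8) _.
move=> t3 r3 m3 [-> Ev3 [S12 S18 S3'] ot3 [ac3 sz3]].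
rewrite S3 in S3'.
apply: exw_seq; apply: exw_conseq (exw_frame (first_phase_spec (z := Ordinal n_gt0) (B := B) m Ev3 S3' _ S12 S18 _)) _ => //.
  lia.
move=> t4 r4 m4 [[Ev4 st4 ot4 ac4 pt4] fr4 _].
have [[R0 R1 R2] _ _ _] := Ev4.
apply: exw_seq; apply: (@exw_add w inp 1); [by rewrite R1 R2|lia|].
set r5 := upd r4 3 1.
have st5 : bfs_state (Ordinal n_gt0) 0 0 r5 m4.
  by apply: bfs_state_ext st4 _ _ => // a ha; rewrite /r5 /upd ifN //; apply/eqP; lia.
have R12 : r5 12 = 1 by rewrite /r5 /upd /= fr4.
have R18 : r5 18 = 0 by rewrite /r5 /upd /= fr4.
have Ev5 : env r5 by apply: env_ext Ev4 _; rewrite /r5 /upd /= !eqxx.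
apply: exw_conseq (main_phase_spec (B := B) Ev5 _ _ R12 R18 st5 _) _ => //.
move=> t6 r6 m6 [pt6 ot6 ac6 [b in6]]; split.
- suff [] : paced B 0 ([:: nop] ++ [:: nop] ++ nop :: rcons (t2 ++ t3 ++ t4 ++ [:: nop] ++ t6) nop) B by [].
  rewrite (_ : _ ++ _ = [:: nop; nop; nop] ++ t2 ++ t3 ++ t4 ++ [:: nop] ++ t6 ++ [:: nop]);
    last by rewrite -cats1 -!catA.
  apply: (@paced_cat _ _ _ 10); first by apply: paced_size => /=; lia.
  apply: paced_cat pt2 _.
  apply: (@paced_cat _ _ _ 100); first by apply: paced_size; lia.
  apply: paced_cat pt4 _; apply: (@paced_cat _ _ _ (5 * slot_time)).
    by apply: paced_size => /=; lia.
  apply: paced_cat pt6 _; apply: paced_size => /=; rewrite /B; lia.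
- rewrite !outsE ot2 ot3 ot4 ot6 /all_outs /= ?catA.
  by rewrite -map_cat cat_take_drop.
- by rewrite !accsE ac2 ac3 /= all_cat ac4 ac6.
- by exists b => i lt; rewrite !accsE ac2 ac3 /= mem_cat in6 ?orbT.
Qed.

(** * Every pair is output exactly once *)

Lemma perm_source_outs u : perm_eq (pair_out u (first u) :: source_outs u (enum 'I_n))
  [seq pair_out u v | v <- [seq v <- enum 'I_n | v != u]].
Proof.
rewrite /source_outs -(map_cons (pair_out u)); apply: perm_map; apply: uniq_perm.
- by rewrite /= filter_uniq ?enum_uniq // andbT mem_filter /skips eqxx orbT.
- by rewrite filter_uniq ?enum_uniq.
move=> v; rewrite in_cons 2!mem_filter mem_enum !andbT /skips.
by case: (v =P first u) => [->|_] /=; rewrite ?first_neq // orbF.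
Qed.

Lemma perm_all_outs : perm_eq all_outs (no_self_apsd E).
Proof.
rewrite /all_outs; set e := enum 'I_n.
have H s : perm_eq (first_outs s ++ flatten [seq source_outs u e | u <- s])
  (flatten [seq [seq pair_out u v | v <- [seq v <- e | v != u]] | u <- s]).
  elim: s => //= u s IH.
  apply: (@perm_trans _ ((pair_out u (first u) :: source_outs u e) ++
     (first_outs s ++ flatten [seq source_outs u e | u <- s]))).
    by rewrite /= perm_cons perm_catCA.
  by apply: perm_cat; [apply: perm_source_outs|].
exact: H.
Qed.

End Specs.

(** * Assembly of the bounds *)

Definition apsd_program : program := compile 0 apsd ++ [:: Halt].

Theorem theorem10 :
  exists (P : program) (k c c1 c2 : nat),
  forall (n w : nat) (E : rel 'I_n) (inp mem0 : nat -> nat),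
    0 < n ->
    k * (trunc_log 2 n).+1 <= w ->
    represents w E inp ->
    (forall a, mem0 a < 2 ^ w) ->
    exists T : nat,
      [/\ halts_at w P inp mem0 T,
          perm_eq (outputs w P inp mem0 T) (no_self_apsd E),
          ((delay w P inp mem0 T)%:R <= c%:R * (1 + avg_degree E))%R,
          n <= c1 * words_used w P inp mem0 T
        & memory_extent w P inp mem0 T <= c2 * n].
Proof.
(* [c] is kept abstract, as a literal of this size would be evaluated in unary. *)
have [c lec] : exists c : nat, 90 * 61 <= c by exists (90 * 61).
exists apsd_program, 8, c, 1, 4 => n w E inp mem0 n_gt0 lew [inp_lt inp0 inpE] _.
have word_big : 64 * n.+1 ^ 2 <= 2 ^ w.
  apply: (@leq_trans (2 ^ (8 * (trunc_log 2 n).+1))); last by rewrite leq_pexp2l.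
  have ltn := trunc_log_ltn n (isT : 1 < 2).
  (* The power of 2 with exponent [(trunc_log 2 n).+1] is at least 2 and at least n + 1: six of its
     eight factors give 64, two give the square. *)
  rewrite (mulnC 8) expnM -[8]/(6 + 2) expnD leq_mul ?leq_exp2r //.
  by rewrite -[64]/(2 ^ 6) leq_exp2r // -[leqLHS]expn1 leq_pexp2l.
have avg_ge0 : (0 <= avg_degree E)%R by rewrite divr_ge0 ?ler0n.
suff [t [r [m [B [[bs_t ok ot [b [acu ac]]] Bn]]]]] : exists t r m B,
    [/\ bs w inp apsd (fun=> 0) mem0 t r m, okgap B 0 t,
        perm_eq (outs t) (no_self_apsd E) & 
        exists b, (forall i, i < n -> b + i \in accs t) /\ all (fun x => x <= 3 * n) (accs t)]
    /\ n * B.+1 <= c * (\sum_(u < n) #|E u| + n).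
  exists (size t).
  have := follows_compile bs_t [::] [:: Halt]; rewrite /= add0n => fol.
  have fh : fetch apsd_program (State (csize apsd) r m) = Halt.
    by rewrite -(size_compile 0) /apsd_program fetch_cat.
  have [h1 -> h3 h4] := follows_halt fol fh ok; split=> //.
  - have n0 : (0 < n%:R :> rat)%R by rewrite ltr0n.
    apply: (@le_trans _ _ (B.+1%:R)%R); first by rewrite ler_nat.
    rewrite /avg_degree -(ler_pM2l n0) mulrCA mulrDr mulr1 mulrCA divff ?gt_eqF // mulr1.
    by rewrite -!natrD -!natrM ler_nat addnC.
  (* The n consecutive addresses from [b] on are all accessed. *)
  - rewrite mul1n /words_used h4 -[leqLHS](size_iota b).
    apply: uniq_leq_size; first exact: iota_uniq.
    move=> x; rewrite mem_iota mem_undup => /andP[h5 h6].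
    by have := acu (x - b); rewrite subnKC //; apply; lia.
  - rewrite /memory_extent h4; apply/bigmax_leqP_seq => x /(allP ac) h5 _; lia.
case: (ltnP 1 n) => [n_gt1|n_le1]; last first.
  have n1 : n = 1 by lia.
  exists [:: nop; nop; nop; (None, [:: 0])].
  do 2 eexists; exists 100; split; last by nia.
  split=> //.
  - apply: (@BsSeq _ _ _ _ _ _ [:: nop]); first exact: BsIns.
    apply: (@BsSeq _ _ _ _ _ _ [:: nop]); first exact: BsIns.
    apply: BsThen; last exact: BsIns.
    by rewrite /= /upd /= inp0 n1 modn_small //; lia.
  - case e: (no_self_apsd E) => [//|x l].
    have : x \in no_self_apsd E by rewrite e mem_head.
    case/allpairsPdep=> u [v [_]]; rewrite mem_filter => /andP[/eqP[]].
    by apply: val_inj => /=; have := ltn_ord u; have := ltn_ord v; lia.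
  - by exists 0; split=> // i; rewrite n1; case: i.
have [adj adjP] := fin_all_exists (fun u => (inpE u).2).
have adj_uniq u : uniq (adj u) by case: (adjP u).
have adj_mem u : adj u =i E u by case: (adjP u).
have adj_list (u : 'I_n) : linked_list w inp (inp (n + u.+1)) [seq v.+1 | v : 'I_n <- adj u].
  by case: (adjP u).
have adj_size (u : 'I_n) : size (adj u) = #|E u|.
  by rewrite -(card_uniqP (adj_uniq u)); apply: eq_card => v; rewrite adj_mem.
have degree_size (u : 'I_n) : inp u.+1 = size (adj u) by rewrite (inpE u).1.
have [t [r [m [h1 [h2 h3 h4 [b h5]]]]]] :=
  apsd_spec word_big adj_uniq adj_mem adj_list degree_size n_gt1 mem0 inp0.
exists t, r, m, (20 * slot_time n inp); split.
  split=> //; first by rewrite h3; apply: perm_all_outs n_gt1.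
  by exists b.+1; split=> // i lt; rewrite addSnnS; apply: h5.
have := budget_leq word_big degree_size n_gt1.
rewrite /slot_time /edge_count; under eq_bigr do rewrite adj_size.
move: (\sum_(u < n) _) (budget n inp) => e K leK.
(* The delay is at most 20 * 30 K + 1, and n K <= 6e + 9n, so n times it is at most 3600 e + 5401 n,
   below 5490 (e + n). *)
apply: (@leq_trans (90 * 61 * (e + n))); last by rewrite leq_mul2r lec orbT.
by rewrite -addn1 mulnDr (mulnCA n) (mulnCA n); lia.
Qed.
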